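(* Let $(A,d,\nu)$ be a dg-algebra. Given a choice of deformation retract of $(A,d)$ onto its homology $(H_*(A),0)$, with chain maps $p:A\to H_*(A)$, $i:H_*(A)\to A$ and homotopy $h:A\to A$ of degree $+1$ satisfying \[ pi=\mathrm{id},\quad \mathrm{id}-ip=dh+hd,\quad h^2=0,\quad ph=0,\quad hi=0, \] suppose that $(H_*(A),m)$ is an $A_\infty$-structure given by $m_1=0$ and, for $n\ge2$, \[ m_n:=-\alpha_n\,p\,\nu h_2\nu_3\cdots h_{n-1}\nu_n\, i^{\otimes n}. \] Then the maps $p_1=p$ and, for $n\ge2$, \[ p_n:=(-1)^n p_{n-1}\nu_n h_n \] define an $A_\infty$-morphism $p:(A,d)\to(H_*(A),m)$.
   Context: Graded vector spaces are $\mathbb Z$-graded over a field $k$; tensor products of graded maps use the Koszul sign convention $(f\otimes g)(v\otimes w)=(-1)^{|g||v|}f(v)\otimes g(w)$. A dg-algebra $(A,d,\nu)$ is a graded associative unital algebra with product $\nu$ of degree $0$ and $d$ of degree $-1$ with $d^2=0$, $d\nu=\nu(d\otimes\mathrm{id}+\mathrm{id}\otimes d)$; it is regarded as an $A_\infty$-algebra with $m_1=d$, $m_2=\nu$, $m_n=0$ for $n\ge3$. Notation: $\alpha_n=(-1)^{n(n-1)/2}$; $h_n=\sum_{r+t=n-1}\mathrm{id}^{\otimes r}\otimes h\otimes(ip)^{\otimes t}:A^{\otimes n}\to A^{\otimes n}$ for $n\ge1$; $\nu_n=\sum_{r+t=n-2}(-1)^t\,\mathrm{id}^{\otimes r}\otimes\nu\otimes\mathrm{id}^{\otimes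 t}:A^{\otimes n}\to A^{\otimes n-1}$ for $n\ge2$ (so $\nu_2=\nu$). For $n=2$ the formula reads $m_2=p\,\nu\, i^{\otimes2}$. An $A_\infty$-algebra $(A,m)$ is a graded vector space with maps $m_n:A^{\otimes n}\to A$ of degree $n-2$, $n\ge1$, such that for all $n\ge1$: $\sum_{r+s+t=n,\ s\ge1}(-1)^{rs+t}m_{r+t+1}(\mathrm{id}^{\otimes r}\otimes m_s\otimes\mathrm{id}^{\otimes t})=0$. An $A_\infty$-morphism $f:(A,m)\to(A',m')$ is a family $f_n:A^{\otimes n}\to A'$ of degree $n-1$ with $\sum_{r+s+t=n}(-1)^{rs+t}f_{r+t+1}(\mathrm{id}^{\otimes r}\otimes m_s\otimes\mathrm{id}^{\otimes t})=\sum_{i_1+\dots+i_r=n}(-1)^{l(i_1,\dots,i_r)}m'_r(f_{i_1}\otimes\dots\otimes f_{i_r})$ for all $n\ge1$, where $l(i_1,\dots,i_r)=\sum_{1\le j<k\le r}(i_k-1)i_j$. *)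

(* Defs.v *)
From HB Require Import structures.
From mathcomp Require Import all_boot all_order all_algebra.
From mathcomp Require Import finmap boolp.
From mathcomp.multinomials Require Import monalg.

Set Implicit Arguments.
Unset Strict Implicit.
Unset Printing Implicit Defensive.

Import Order.TTheory GRing.Theory Num.Theory.

Local Open Scope ring_scope.
Local Open Scope quotient_scope.

(* Quotient of a k-module by a submodule, on top of [Quotient.quot], which is
   only a Z-module. *)
Record submod (k : fieldType) (V : lmodType k) := Submod {
  submod_mem :> V -> Prop;
  submod0 : submod_mem 0;
  submodP : forall c x y,
    submod_mem x -> submod_mem y -> submod_mem (c *: x + y)
}.

Section LmodQuotient.
Variables (k : fieldType) (V : lmodType k) (S : submod V).

Definition submod_pred : {pred V} := fun x => `[< S x >].

Fact submod_pred_zmod_closed : zmod_closed submod_pred.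
Proof.
split=> [|x y /asboolP Sx /asboolP Sy]; apply/asboolP; first exact: submod0.
by rewrite addrC -scaleN1r; apply: submodP.
Qed.
HB.instance Definition _ := GRing.isZmodClosed.Build V submod_pred
  submod_pred_zmod_closed.

Definition lquot := Quotient.quot submod_pred.
HB.instance Definition _ := GRing.Zmodule.on lquot.

Definition lpi (x : V) : lquot := \pi_(Quotient.quot submod_pred) x.
Definition lrepr (x : lquot) : V := repr x.

Lemma lreprK (x : lquot) : lpi (lrepr x) = x.
Proof. exact: reprK. Qed.

Lemma lpiD : {morph lpi : x y / x + y}.
Proof. exact: Quotient.pi_add. Qed.

Lemma lpi_eq (x y : V) : (lpi x = lpi y) <-> S (x - y).
Proof.
have -> : S (x - y) <-> (x - y \in submod_pred).
  by split=> [Sxy|/asboolP]; first exact/asboolP.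
by rewrite /lpi Quotient.idealrBE; split => [->|/eqP].
Qed.

Definition lquot_scale (c : k) (x : lquot) : lquot := lpi (c *: lrepr x).

Lemma lpiZ c x : lquot_scale c (lpi x) = lpi (c *: x).
Proof.
apply/lpi_eq; rewrite -scalerBr -[_ *: _]addr0.
by apply: submodP; [apply/lpi_eq; rewrite lreprK | apply: submod0].
Qed.

Fact lquot_scaleA a b x :
  lquot_scale a (lquot_scale b x) = lquot_scale (a * b) x.
Proof. by rewrite -[x]lreprK !lpiZ scalerA. Qed.
Fact lquot_scale1 : left_id 1 lquot_scale.
Proof. by move=> x; rewrite -[x]lreprK !lpiZ scale1r. Qed.
Fact lquot_scaleDr : right_distributive lquot_scale +%R.
Proof.
by move=> c x y; rewrite -[x]lreprK -[y]lreprK -lpiD !lpiZ scalerDr lpiD.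
Qed.
Fact lquot_scaleDl x : {morph lquot_scale^~ x : a b / a + b}.
Proof. by move=> a b /=; rewrite -[x]lreprK !lpiZ scalerDl lpiD. Qed.

HB.instance Definition _ := GRing.Zmodule_isLmodule.Build k lquot
  lquot_scaleA lquot_scale1 lquot_scaleDr lquot_scaleDl.

Fact lpi_is_linear : linear lpi.
Proof. by move=> c x y; rewrite lpiD -lpiZ. Qed.
HB.instance Definition _ := GRing.isLinear.Build k V lquot *:%R lpi
  lpi_is_linear.

End LmodQuotient.

(* A Z-grading V = \bigoplus_j V_j, given by the projections onto the V_j. *)
HB.mixin Record isGraded (k : fieldType) V of GRing.Lmodule k V := {
  gcomp : int -> V -> V;
  gcomp_linear : forall j, linear (gcomp j);
  gcompK : forall i j v, gcomp i (gcomp j v) = if i == j then gcomp j v else 0;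
  gcomp_sum : forall v, exists s : seq int,
    uniq s && (v == \sum_(j <- s) gcomp j v)
}.

#[short(type="gradedType")]
HB.structure Definition Graded (k : fieldType) :=
  {V of GRing.Lmodule k V & isGraded k V}.

HB.instance Definition _ (k : fieldType) (V : gradedType k) (j : int) :=
  GRing.isLinear.Build k V V *:%R (@gcomp k V j) (gcomp_linear j).

Section Graded.
Variables (k : fieldType).
Implicit Types V W : gradedType k.

Definition homog V (j : int) (v : V) : Prop := gcomp j v = v.

Definition gsupp V (v : V) : seq int := xchoose (gcomp_sum v).

(* The Koszul operator: v |-> (-1)^(e * |v|) v for v homogeneous. *)
Definition koszul V (e : int) (v : V) : V :=
  \sum_(j <- gsupp v) (-1) ^+ absz (e * j) *: gcomp j v.

Definition hdeg V W (e : int) (f : V -> W) : Prop :=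
  forall j v, homog j v -> homog (j + e) (f v).

Lemma gsuppE V (v : V) : v = \sum_(j <- gsupp v) gcomp j v.
Proof. by have /andP[_ /eqP] := xchooseP (gcomp_sum v). Qed.

Lemma gsupp_uniq V (v : V) : uniq (gsupp v).
Proof. by have /andP[] := xchooseP (gcomp_sum v). Qed.

Lemma gcomp_homog V j (v : V) : homog j (gcomp j v).
Proof. by rewrite /homog gcompK eqxx. Qed.

Lemma gcomp_notin V j (v : V) : j \notin gsupp v -> gcomp j v = 0.
Proof.
move=> jv; rewrite [v in LHS]gsuppE linear_sum big_seq big1 // => i iv.
by rewrite /= gcompK; case: eqP iv jv => // -> ->.
Qed.

Lemma gsum_ext V (v : V) (c : int -> k) (s : seq int) :
  uniq s -> {subset gsupp v <= s} ->
  \sum_(j <- gsupp v) c j *: gcomp j v = \sum_(j <- s) c j *: gcomp j v.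
Proof.
move=> us vs.
rewrite [RHS](bigID (mem (gsupp v))) /= [X in _ = _ + X]big1 ?addr0; last first.
  by move=> j jv; rewrite gcomp_notin // scaler0.
rewrite -[RHS]big_filter; apply: perm_big; apply: uniq_perm.
- exact: gsupp_uniq.
- exact: filter_uniq.
move=> j; rewrite mem_filter /=; apply/idP/andP => [jv|[]//].
by split=> //; apply: vs.
Qed.

Fact koszul_is_linear V e : linear (@koszul V e).
Proof.
move=> c u v; rewrite /koszul.
set s := undup (gsupp u ++ gsupp v ++ gsupp (c *: u + v)).
have us : uniq s by exact: undup_uniq.
rewrite !(@gsum_ext _ _ (fun j => (-1) ^+ absz (e * j)) s) //.
- rewrite scaler_sumr -big_split; apply: eq_bigr => j _ /=.
  by rewrite linearP scalerDr !scalerA mulrC.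
- by move=> j jv; rewrite mem_undup !mem_cat jv ?orbT.
- by move=> j jv; rewrite mem_undup !mem_cat jv ?orbT.
- by move=> j jv; rewrite mem_undup !mem_cat jv ?orbT.
Qed.
HB.instance Definition _ V e := GRing.isLinear.Build k V V *:%R (@koszul V e)
  (@koszul_is_linear V e).

Lemma koszul_homog V e j (v : V) :
  homog j v -> koszul e v = (-1) ^+ absz (e * j) *: v.
Proof.
move=> hv; rewrite /koszul [in RHS](gsuppE v) scaler_sumr.
apply: eq_bigr => i _; rewrite -hv gcompK.
by case: eqP => [->|_] //; rewrite !scaler0.
Qed.

Lemma gcomp_hdeg V W e (f : {linear V -> W}) (fe : hdeg e f) j v :
  f (gcomp j v) = gcomp (j + e) (f v).
Proof.
rewrite [v in RHS]gsuppE !linear_sum /=.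
under eq_bigr => i _.
  rewrite -(fe _ _ (gcomp_homog i v)) gcompK (inj_eq (addIr e)).
  over.
have [jv|jv] := boolP (j \in gsupp v).
  rewrite (bigD1_seq j) ?gsupp_uniq //= eqxx big1 ?addr0 => [|i ij].
    by rewrite (fe _ _ (gcomp_homog j v)).
  by rewrite eq_sym (negPf ij).
rewrite gcomp_notin // linear0 big_seq big1 // => i iv.
by case: eqP iv jv => // -> ->.
Qed.

End Graded.

Record complex (k : fieldType) := Complex {
  cgr :> gradedType k;
  cdiff : {linear cgr -> cgr};
  cdiff_deg : hdeg (-1) cdiff;
  cdiffK : forall x, cdiff (cdiff x) = 0
}.
Arguments cdiff {k} c.

Section Homology.
Variables (k : fieldType) (C : complex k).
Local Notation d := (cdiff C).

Definition is_cycle : {pred C} := fun x => d x == 0.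

Fact is_cycleE x : (x \in is_cycle) = (d x == 0). Proof. by []. Qed.

Fact is_cycle_submod_closed : subsemimod_closed is_cycle.
Proof.
split; first split.
- by rewrite is_cycleE linear0.
- by move=> x y; rewrite !is_cycleE linearD => /eqP-> /eqP->; rewrite addr0.
- by move=> c x; rewrite !is_cycleE linearZ => /eqP->; rewrite /= scaler0.
Qed.
HB.instance Definition _ := GRing.isSubmodClosed.Build k C is_cycle
  is_cycle_submod_closed.

Record cycle := Cycle { cycle_val : C; cycleP : cycle_val \in is_cycle }.
HB.instance Definition _ := [isSub for cycle_val].
HB.instance Definition _ := [Choice of cycle by <:].
HB.instance Definition _ := [SubChoice_isSubLmodule of cycle by <:].

Fact cycle_val_is_linear : linear cycle_val.
Proof. exact: (linearP (\val : cycle -> C)). Qed.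
HB.instance Definition _ := GRing.isLinear.Build k cycle C *:%R cycle_val
  cycle_val_is_linear.

Fact boundary0 : exists y, cycle_val 0 = d y.
Proof. by exists 0; rewrite !linear0. Qed.
Fact boundaryP c (x y : cycle) :
  (exists z, cycle_val x = d z) -> (exists z, cycle_val y = d z) ->
  exists z, cycle_val (c *: x + y) = d z.
Proof.
by move=> [u xu] [v yv]; exists (c *: u + v); rewrite linearP -xu -yv.
Qed.
Definition boundary : submod cycle := Submod boundary0 boundaryP.

Definition homology := lquot boundary.
HB.instance Definition _ := GRing.Lmodule.on homology.

Definition hclass (z : cycle) : homology := lpi boundary z.
Fact hclass_is_linear : linear hclass.
Proof. exact: lpi_is_linear. Qed.
HB.instance Definition _ := GRing.isLinear.Build k cycle homology *:%R hclass
  hclass_is_linear.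

Fact gcomp_cycle j (z : cycle) : gcomp j (cycle_val z) \in is_cycle.
Proof.
by rewrite is_cycleE (gcomp_hdeg (@cdiff_deg _ C)) (eqP (cycleP z)) linear0.
Qed.

Definition cycle_comp j (z : cycle) : cycle := Cycle (gcomp_cycle j z).

Definition homology_comp (j : int) (x : homology) : homology :=
  hclass (cycle_comp j (lrepr x)).

Lemma homology_compE j z :
  homology_comp j (hclass z) = hclass (cycle_comp j z).
Proof.
apply/lpi_eq; have /lpi_eq [y yE] := lreprK (hclass z).
exists (gcomp (j + 1) y); rewrite (gcomp_hdeg (@cdiff_deg _ C)) addrK -yE.
by rewrite !raddfB.
Qed.

Lemma hclassP (x : homology) : exists z, x = hclass z.
Proof. by exists (lrepr x); rewrite [RHS]lreprK. Qed.

Fact homology_comp_linear j : linear (homology_comp j).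
Proof.
move=> c x y; have [u ->] := hclassP x; have [v ->] := hclassP y.
rewrite -linearP !homology_compE -linearP; congr hclass.
by apply: val_inj; rewrite /= !linearP.
Qed.

Fact homology_compK i j x :
  homology_comp i (homology_comp j x) = if i == j then homology_comp j x else 0.
Proof.
have [z ->] := hclassP x; rewrite !homology_compE -(linear0 hclass) -fun_if.
congr hclass; apply: val_inj; rewrite /= gcompK; case: ifP => //= _.
Qed.

Fact homology_comp_sum x : exists s : seq int,
  uniq s && (x == \sum_(j <- s) homology_comp j x).
Proof.
have [z ->] := hclassP x; exists (gsupp (cycle_val z)).
rewrite gsupp_uniq; apply/eqP.
under eq_bigr do rewrite homology_compE.
rewrite -linear_sum; congr hclass; apply: val_inj.
by rewrite raddf_sum /= [LHS]gsuppE.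
Qed.

HB.instance Definition _ := isGraded.Build k homology
  homology_comp_linear homology_compK homology_comp_sum.

End Homology.

(* The tensor power V^{\otimes n}: the free module on the n-tuples of vectors,
   modulo the multilinearity relations. *)
Section TensorPower.
Variables (k : fieldType) (n : nat) (V : lmodType k).
Implicit Types (W : lmodType k) (a : {ffun 'I_n -> V}).

Definition upd a (i : 'I_n) (v : V) : {ffun 'I_n -> V} :=
  [ffun j => if j == i then v else a j].

Inductive mlspan : {malg k[{ffun 'I_n -> V}]} -> Prop :=
| Mlspan0 : mlspan 0
| MlspanP c x y : mlspan x -> mlspan y -> mlspan (c *: x + y)
| MlspanR a i (c : k) (u v : V) :
    mlspan (<< upd a i (c *: u + v) >>
            - (c *: << upd a i u >> + << upd a i v >>)).

Definition tens := lquot (Submod Mlspan0 MlspanP).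
HB.instance Definition _ := GRing.Lmodule.on tens.

Definition tpure a : tens := lpi (Submod Mlspan0 MlspanP) << a >>.

(* s_0 (x) ... (x) s_(n-1); meant for lists of size n. *)
Definition tprod (s : seq V) : tens := tpure [ffun i : 'I_n => s`_i].

Definition multilinear W (g : {ffun 'I_n -> V} -> W) : Prop :=
  forall a i (c : k) (u v : V),
    g (upd a i (c *: u + v)) = c *: g (upd a i u) + g (upd a i v).

Definition free_ext W (g : {ffun 'I_n -> V} -> W)
    (x : {malg k[{ffun 'I_n -> V}]}) : W :=
  \sum_(a <- msupp x) x@_a *: g a.

(* The linear map V^{\otimes n} -> W induced by a multilinear map (0 if g is not
   multilinear). *)
Definition tlift W (g : {ffun 'I_n -> V} -> W) (x : tens) : W :=
  if `[< multilinear g >] then free_ext g (lrepr x) else 0.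

Lemma free_extE W (g : {ffun 'I_n -> V} -> W) (d : {fset {ffun 'I_n -> V}}) x :
  (msupp x `<=` d)%fset -> free_ext g x = \sum_(a <- d) x@_a *: g a.
Proof.
move=> le; rewrite [LHS](big_fset_incl _ le) // => a _ /mcoeff_outdom ->.
by rewrite scale0r.
Qed.

Fact free_ext_linear W (g : {ffun 'I_n -> V} -> W) : linear (free_ext g).
Proof.
move=> c x y.
pose d := (msupp x `|` msupp y `|` msupp (c *: x + y))%fset.
rewrite !(@free_extE _ g d).
- rewrite scaler_sumr -big_split /=; apply: eq_bigr => a _.
  by rewrite mcoeffD mcoeffZ scalerDl scalerA.
- by apply/fsubsetP=> a; rewrite !in_fsetU => ->; rewrite ?orbT.
- by apply/fsubsetP=> a; rewrite !in_fsetU => ->; rewrite ?orbT.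
- by apply/fsubsetP=> a; rewrite !in_fsetU => ->; rewrite ?orbT.
Qed.
HB.instance Definition _ W (g : {ffun 'I_n -> V} -> W) :=
  GRing.isLinear.Build k _ W *:%R (free_ext g) (free_ext_linear g).

Lemma free_extU W (g : {ffun 'I_n -> V} -> W) a : free_ext g << a >> = g a.
Proof.
rewrite (free_extE _ (d := [fset a]%fset)); last exact: msuppU_le.
by rewrite big_seq_fset1 mcoeffUU scale1r.
Qed.

Lemma free_ext_mlspan W (g : {ffun 'I_n -> V} -> W) x :
  multilinear g -> mlspan x -> free_ext g x = 0.
Proof.
move=> gml; elim=> {x} [|c x y _ x0 _ y0|a i c u v]; first exact: linear0.
  by rewrite linearP /= x0 y0 scaler0 addr0.
by rewrite linearB linearP /= !free_extU gml subrr.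
Qed.

Lemma tlift_lpi W (g : {ffun 'I_n -> V} -> W) x : multilinear g ->
  tlift g (lpi (Submod Mlspan0 MlspanP) x) = free_ext g x.
Proof.
move=> gml; rewrite /tlift (asboolT gml); apply/eqP; rewrite -subr_eq0 -linearB.
apply/eqP/free_ext_mlspan => //.
by have /lpi_eq := lreprK (lpi (Submod Mlspan0 MlspanP) x).
Qed.

Lemma tlift_pure W (g : {ffun 'I_n -> V} -> W) a : multilinear g ->
  tlift g (tpure a) = g a.
Proof. by move=> gml; rewrite tlift_lpi // free_extU. Qed.

Fact tlift_is_linear W (g : {ffun 'I_n -> V} -> W) : linear (tlift g).
Proof.
have [gml|gml] := asboolP (multilinear g); last first.
  by move=> c x y; rewrite /tlift (asboolF gml) scaler0 addr0.
move=> c x y; rewrite -[x]lreprK -[y]lreprK -linearP !tlift_lpi //.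
by rewrite linearP.
Qed.
HB.instance Definition _ W (g : {ffun 'I_n -> V} -> W) :=
  GRing.isLinear.Build k tens W *:%R (tlift g) (tlift_is_linear g).

Lemma tpure_multilinear : multilinear tpure.
Proof.
move=> a i c u v; rewrite /tpure -linearP; apply/lpi_eq.
exact: MlspanR.
Qed.

Lemma tens_ext W (f g : {linear tens -> W}) :
  (forall a, f (tpure a) = g (tpure a)) -> f =1 g.
Proof.
move=> fg x; rewrite -[x]lreprK [lrepr x]monalgE !linear_sum.
apply: eq_bigr => a _.
have -> : << (lrepr x)@_a *g a >> = (lrepr x)@_a *: << a >>
    :> {malg k[{ffun 'I_n -> V}]}.
  by apply/malgP => b; rewrite mcoeffZ !mcoeffU mulrnAr mulr1.
by rewrite !linearZ /=; congr (_ *: _); apply: fg.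
Qed.

End TensorPower.

Section TensorOfMaps.
Variables k : fieldType.
Implicit Types V W : gradedType k.

(* f : V^{\otimes n} -> W maps V_(j_1) (x) ... (x) V_(j_n) to
   W_(j_1 + ... + j_n + e). *)
Definition tdeg V W (n : nat) (e : int) (f : tens n V -> W) : Prop :=
  forall (a : {ffun 'I_n -> V}) (j : 'I_n -> int),
    (forall i, homog (j i) (a i)) ->
    homog (\sum_(i < n) j i + e) (f (tpure a)).

(* A map V^{\otimes bar} -> W, labelled with its degree. *)
Record block V W := Block {
  bar : nat;
  bdeg : int;
  bmap : {linear tens bar V -> W}
}.

Definition tens1 V : tens 1 V -> V := tlift (fun a => a ord0).
HB.instance Definition _ V := GRing.Linear.on (@tens1 V).

Definition block1 V W (e : int) (f : {linear V -> W}) : block V W :=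
  Block e (f \o @tens1 V).

Definition idblock V : block V V := Block 0 (@tens1 V).

(* The factors of (f_1 (x) ... (x) f_r)(s_1 (x) ... (x) s_n): by the Koszul
   rule f_2 (x) ... (x) f_r moves past the arguments of f_1. *)
Fixpoint tword V W (bs : seq (block V W)) (s : seq V) : seq W :=
  if bs is b :: bs' then
    bmap b (tprod (bar b)
             [seq koszul (\sum_(b' <- bs') bdeg b') v | v <- take (bar b) s])
      :: tword bs' (drop (bar b) s)
  else [::].

(* f_1 (x) ... (x) f_q : V^{\otimes n} -> W^{\otimes q} for bs = f_1, ..., f_q
   of total arity n, see [tmap_pure]. *)
Definition tmap V W (n q : nat) (bs : seq (block V W)) : tens n V -> tens q W :=
  tlift (fun a => tprod q (tword bs (codom a))).
HB.instance Definition _ V W n q (bs : seq (block V W)) :=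
  GRing.Linear.on (@tmap V W n q bs).

(* id^{\otimes r} (x) f (x) g^{\otimes t} *)
Definition insertb V (r : nat) (f : block V V) (t : nat) (g : block V V) :=
  nseq r (idblock V) ++ f :: nseq t g.

End TensorOfMaps.
Arguments tens1 {k} V.
Arguments idblock {k} V.

Section TensorOfMapsTheory.
Variables k : fieldType.
Implicit Types V W : gradedType k.

Lemma tens1_pure V (a : {ffun 'I_1 -> V}) : tens1 V (tpure a) = a ord0.
Proof.
by apply: tlift_pure => b i c u v; rewrite (ord1 i) !ffunE.
Qed.

Lemma tprod_linear V n (s1 s2 : seq V) : (size s1 < n)%N ->
  linear (fun v => tprod n (s1 ++ v :: s2)).
Proof.
move=> lt_s1 c u v; pose i := Ordinal lt_s1.
pose a := [ffun j : 'I_n => (s1 ++ 0 :: s2)`_j].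
have aE w : tprod n (s1 ++ w :: s2) = tpure (upd a i w).
  congr tpure; apply/ffunP => j; rewrite !ffunE -val_eqE /= !nth_cat.
  case: ltngtP => // [lt_j|->]; last by rewrite subnn.
  by rewrite -subnSK.
by rewrite !aE tpure_multilinear.
Qed.

Lemma size_tword V W (bs : seq (block V W)) s : size (tword bs s) = size bs.
Proof. by elim: bs s => //= b bs IH s; rewrite IH. Qed.

Lemma tword_linear V W (bs : seq (block V W)) (s1 s2 : seq V) :
  (size s1 < sumn [seq bar b | b <- bs])%N ->
  exists ws1 ws2 (L : V -> W), linear L /\
    forall v, tword bs (s1 ++ v :: s2) = ws1 ++ L v :: ws2.
Proof.
elim: bs s1 => //= b bs IH s1 lt_s1.
have [lt_b|le_b] := ltnP (size s1) (bar b).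
  set e := \sum_(b' <- bs) bdeg b'.
  have tE v : take (bar b) (s1 ++ v :: s2)
      = s1 ++ v :: take (bar b - (size s1).+1) s2.
    by rewrite take_cat ltnNge (ltnW lt_b) /= -(subnSK lt_b).
  have dE v : drop (bar b) (s1 ++ v :: s2)
      = drop (bar b - (size s1).+1) s2.
    by rewrite drop_cat ltnNge (ltnW lt_b) /= -(subnSK lt_b).
  exists [::], (tword bs (drop (bar b - (size s1).+1) s2)).
  exists (fun v => bmap b (tprod (bar b) (map (koszul e) s1 ++ koszul e v
           :: map (koszul e) (take (bar b - (size s1).+1) s2)))).
  split=> [c u v|v]; last by rewrite /= tE dE map_cat.
  rewrite linearP.
  by rewrite (@tprod_linear _ _ (map (koszul e) s1)) ?size_map // linearP.
have lt_d : (size (drop (bar b) s1) < sumn [seq bar b | b <- bs])%N.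
  by rewrite size_drop ltn_subLR.
have [ws1 [ws2 [L [Llin LE]]]] := IH _ lt_d.
exists (bmap b (tprod (bar b)
   [seq koszul (\sum_(b' <- bs) bdeg b') v | v <- take (bar b) s1]) :: ws1).
exists ws2, L; split=> // v.
rewrite /= take_cat drop_cat; move: le_b; rewrite leq_eqVlt.
case/orP=> [/eqP eb|lt_b]; last by rewrite lt_b LE.
rewrite -LE -eb ltnn subnn take0 drop0 cats0.
by rewrite take_oversize ?drop_oversize ?eb.
Qed.

Lemma codom_upd V n (a : {ffun 'I_n -> V}) i v :
  codom (upd a i v) = take i (codom a) ++ v :: drop i.+1 (codom a).
Proof.
have sz (b : {ffun 'I_n -> V}) : size (codom b) = n.
  by rewrite size_codom card_ord.
apply: (@eq_from_nth _ 0); rewrite sz.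
  rewrite size_cat /= size_drop size_takel ?sz ?(ltnW (ltn_ord i)) //.
  by rewrite -addSnnS subnKC.
move=> j lt_j; pose jo := Ordinal lt_j.
have nthE (b : {ffun 'I_n -> V}) : (codom b)`_j = b jo.
  by rewrite /codom /image_mem (nth_map jo) ?size_enum_ord // (nth_ord_enum _ jo).
rewrite nthE ffunE nth_cat size_takel ?sz; last exact: ltnW.
rewrite -val_eqE /=; case: ltngtP => [lt_ji|lt_ij|->].
- by rewrite nth_take // nthE.
- by rewrite -subnSK //= nth_drop subnKC // nthE.
- by rewrite subnn.
Qed.

Lemma tmap_multilinear V W n q (bs : seq (block V W)) :
  sumn [seq bar b | b <- bs] = n -> size bs = q ->
  multilinear (fun a : {ffun 'I_n -> V} => tprod q (tword bs (codom a))).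
Proof.
move=> bsn bsq a i c u v.
have [|ws1 [ws2 [L [Llin LE]]]] :=
    @tword_linear V W bs (take i (codom a)) (drop i.+1 (codom a)).
  by rewrite bsn size_takel ?ltn_ord // size_codom card_ord ltnW.
rewrite !codom_upd !LE Llin tprod_linear //.
rewrite -bsq -(size_tword bs (take i (codom a) ++ 0 :: drop i.+1 (codom a))) LE.
by rewrite size_cat /= -addSnnS leq_addr.
Qed.

Lemma tmap_pure V W n q (bs : seq (block V W)) (a : {ffun 'I_n -> V}) :
  sumn [seq bar b | b <- bs] = n -> size bs = q ->
  tmap q bs (tpure a) = tprod q (tword bs (codom a)).
Proof. by move=> bsn bsq; rewrite /tmap tlift_pure //; apply: tmap_multilinear. Qed.

End TensorOfMapsTheory.

Record dgAlgebra (k : fieldType) := DgAlgebra {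
  dga_complex :> complex k;
  dga_mul : {linear tens 2 dga_complex -> dga_complex};
  dga_one : dga_complex;
  dga_mul_deg : tdeg 0 dga_mul;
  dga_one_deg : homog 0 dga_one;
  dga_mulA : forall x : tens 3 dga_complex,
    dga_mul (tmap 2 [:: Block 0 dga_mul; idblock dga_complex] x)
    = dga_mul (tmap 2 [:: idblock dga_complex; Block 0 dga_mul] x);
  dga_mul1l : forall a, dga_mul (tprod 2 [:: dga_one; a]) = a;
  dga_mul1r : forall a, dga_mul (tprod 2 [:: a; dga_one]) = a;
  dga_leibniz : forall x : tens 2 dga_complex,
    cdiff dga_complex (dga_mul x)
    = dga_mul
        (tmap 2 [:: block1 (-1) (cdiff dga_complex); idblock dga_complex] x
         + tmap 2 [:: idblock dga_complex; block1 (-1) (cdiff dga_complex)] x)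
}.

Section AInfinity.
Variable k : fieldType.
Implicit Types V W : gradedType k.

(* The component of index 0 of a family [m] or [f] below is a dummy, which
   neither definition looks at. *)
Definition Ainf_algebra V (m : forall n, {linear tens n V -> V}) : Prop :=
  (forall n, (0 < n)%N -> tdeg (n%:Z - 2) (m n)) /\
  (forall n, (0 < n)%N -> forall x : tens n V,
     \sum_(1 <= s < n.+1) \sum_(0 <= r < (n - s).+1)
       (let t := (n - s - r)%N in
        (-1) ^+ (r * s + t) *:
          m (r + t + 1)%N
            (tmap _ (insertb r (Block (s%:Z - 2) (m s)) t (idblock V)) x))
     = 0).

(* Exponent of the sign of m'_r (f_(i_1) (x) ... (x) f_(i_r)). *)
Definition comp_sign (c : seq nat) : nat :=
  (\sum_(j < size c) \sum_(l < size c | j < l) (nth 0 c l - 1) * nth 0 c j)%N.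

Definition Ainf_morphism V W (m : forall n, {linear tens n V -> V})
    (m' : forall n, {linear tens n W -> W})
    (f : forall n, {linear tens n V -> W}) : Prop :=
  (forall n, (0 < n)%N -> tdeg (n%:Z - 1) (f n)) /\
  (forall n, (0 < n)%N -> forall x : tens n V,
     \sum_(1 <= s < n.+1) \sum_(0 <= r < (n - s).+1)
       (let t := (n - s - r)%N in
        (-1) ^+ (r * s + t) *:
          f (r + t + 1)%N
            (tmap _ (insertb r (Block (s%:Z - 2) (m s)) t (idblock V)) x))
     = \sum_(1 <= r < n.+1)
         \sum_(c : r.-tuple 'I_n.+1 |
                 all (leq 1) (map val c) && (sumn (map val c) == n))
           (-1) ^+ comp_sign (map val c) *:
             m' r (tmap r [seq Block (s%:Z - 1) (f s) | s <- map val c] x)).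

Definition dga_Ainf (A : dgAlgebra k) (n : nat) : {linear tens n A -> A} :=
  match n with
  | 1 => cdiff A \o tens1 A
  | 2 => dga_mul A
  | _ => \0
  end.

End AInfinity.

Section Transfer.
Variables (k : fieldType) (A : dgAlgebra k).
Local Notation H := (homology A).
Variables (p : {linear A -> H}) (i : {linear H -> A}) (h : {linear A -> A}).

Definition alpha_sign (n : nat) : k := (-1) ^+ (n * (n - 1))./2.

Definition h_op (n : nat) (x : tens n A) : tens n A :=
  \sum_(r < n)
    tmap n (insertb r (block1 1 h) (n - 1 - r) (block1 0 (i \o p))) x.

Definition nu_op (n : nat) (x : tens n A) : tens n.-1 A :=
  \sum_(r < n.-1) (let t := (n - 2 - r)%N in
    (-1) ^+ t *: tmap n.-1 (insertb r (Block 0 (dga_mul A)) t (idblock A)) x).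

Fact h_op_linear n : linear (@h_op n).
Proof.
move=> c x y; rewrite /h_op scaler_sumr -big_split; apply: eq_bigr => r _.
exact: linearP.
Qed.
HB.instance Definition _ n := GRing.isLinear.Build k _ _ *:%R (@h_op n)
  (@h_op_linear n).

Fact nu_op_linear n : linear (@nu_op n).
Proof.
move=> c x y; rewrite /nu_op scaler_sumr -big_split; apply: eq_bigr => r _ /=.
by rewrite linearP scalerDr !scalerA mulrC.
Qed.
HB.instance Definition _ n := GRing.isLinear.Build k _ _ *:%R (@nu_op n)
  (@nu_op_linear n).

(* nu h_2 nu_3 ... h_(n+1) nu_(n+2) *)
Fixpoint nu_chain (n : nat) : {linear tens n.+2 A -> A} :=
  match n with
  | 0 => dga_mul A
  | n'.+1 => nu_chain n' \o @h_op n'.+2 \o @nu_op n'.+3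
  end.

Definition transfer_m (n : nat) : {linear tens n H -> H} :=
  match n with
  | n'.+2 => - alpha_sign n'.+2 \*:
      (p \o nu_chain n' \o @tmap k H A n'.+2 n'.+2 (nseq n'.+2 (block1 0 i)))
  | _ => \0
  end.

(* p_(n+1) *)
Fixpoint transfer_p_rec (n : nat) : {linear tens n.+1 A -> H} :=
  match n with
  | 0 => p \o tens1 A
  | n'.+1 => (-1) ^+ n'.+2 \*:
      (transfer_p_rec n' \o @nu_op n'.+2 \o @h_op n'.+2)
  end.

Definition transfer_p (n : nat) : {linear tens n A -> H} :=
  match n with
  | 0 => \0
  | n'.+1 => transfer_p_rec n'
  end.

End Transfer.

(* Main.v *)
From HB Require Import structures.
Require Import Defs.
From mathcomp Require Import all_boot all_order all_algebra.
From mathcomp Require Import zify ring.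

(* Write D, N, h, g for the maps induced on A^{(x) n} by d, nu, the homotopy and
   ip, and P_n for p_n. The tensor trick gives D h + h D = id - g, associativity
   gives N N = 0, and D commutes with N. As P_n = (-1)^n P_(n-1) N h, the left
   hand side L_n = (-1)^(n-1) P_n D + P_(n-1) N of the morphism equation satisfies
     L_n = P_(n-1) N g + (-1)^n L_(n-1) N h,
   where P_(n-1) N g = m_n p^{(x) n}. The right hand side R_n satisfies the same
   recursion: for r < n, in
     sum over i_1 + ... + i_r = n - 1 of +- (P_(i_1) (x) ... (x) P_(i_r)) N h
   every term containing h h, h g, g h or p h vanishes, and what is left is the
   same sum over i_1 + ... + i_r = n; for r = n it is m_n p^{(x) n}.
   Maps out of A^{(x) n} are handled as multilinear functions of lists of
   vectors. *)

Set Implicit Arguments.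
Unset Strict Implicit.
Unset Printing Implicit Defensive.

Import GRing.Theory.
Local Open Scope ring_scope.

(** * Consequences of linearity for functions without a bundled linear structure *)

Section LinearFunctions.
Variables (k : fieldType) (V W : lmodType k).

Lemma linear_fun0 (f : V -> W) : linear f -> f 0 = 0.
Proof. by move=> fL; have := fL (-1) 0 0; rewrite scaler0 addr0 scaleN1r addNr. Qed.

Lemma linear_funN (f : V -> W) v : linear f -> f (- v) = - f v.
Proof.
move=> fL; have := fL (-1) v 0.
by rewrite (linear_fun0 fL) !addr0 !scaleN1r.
Qed.

Lemma linear_funD (f : V -> W) u v : linear f -> f (u + v) = f u + f v.
Proof. by move=> fL; have := fL 1 u v; rewrite !scale1r. Qed.

Lemma linear_funZ (f : V -> W) c v : linear f -> f (c *: v) = c *: f v.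
Proof. by move=> fL; have := fL c v 0; rewrite (linear_fun0 fL) !addr0. Qed.

Lemma linear_fun_sum (I : Type) (r : seq I) (f : V -> W) (F : I -> V) :
  linear f -> f (\sum_(j <- r) F j) = \sum_(j <- r) f (F j).
Proof.
move=> fL; apply: (big_morph f) => [u v|]; first exact: linear_funD.
exact: linear_fun0.
Qed.

End LinearFunctions.

(** * The Koszul sign operator *)

Section KoszulOperator.
Variables (k : fieldType).
Implicit Types V W : gradedType k.

Lemma sign_absz_odd (R : pzRingType) (a b : int) :
  odd (absz a) = odd (absz b) -> (-1) ^+ absz a = (-1) ^+ absz b :> R.
Proof. by move=> ab; rewrite -signr_odd ab signr_odd. Qed.

Lemma signr_parity (R : pzRingType) (m n : nat) :
  odd m = odd n -> (-1) ^+ m = (-1) ^+ n :> R.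
Proof. by move=> mn; rewrite -signr_odd mn signr_odd. Qed.

Lemma signr_even (R : pzRingType) (n : nat) : ~~ odd n -> (-1) ^+ n = 1 :> R.
Proof. by rewrite -signr_odd => /negPf ->. Qed.

(** Only the parity of the exponent matters; the explicit witness [c] leaves a linear side
    condition. *)
Lemma koszul_parity V (a b c : int) (v : V) :
  a = b + c * 2 -> koszul a v = koszul b v.
Proof.
move=> ->; rewrite /koszul; apply: eq_bigr => j _; congr (_ *: _).
by apply: sign_absz_odd; lia.
Qed.

Lemma koszul0 V (v : V) : koszul 0 v = v.
Proof.
rewrite [RHS]gsuppE /koszul; apply: eq_bigr => j _.
by rewrite mul0r expr0 scale1r.
Qed.

(** Every vector is the finite sum of its homogeneous components. *)
Lemma eq_on_homog V W (f g : V -> W) : linear f -> linear g ->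
  (forall j v, homog j v -> f v = g v) -> f =1 g.
Proof.
move=> fL gL fg v; rewrite [v]gsuppE !linear_fun_sum //; apply: eq_bigr => j _.
exact: fg (gcomp_homog j v).
Qed.

Lemma koszulD V (a b : int) (v : V) : koszul a (koszul b v) = koszul (a + b) v.
Proof.
apply: (@eq_on_homog _ _ (koszul a \o koszul b) (koszul (a + b))) => [||j u hu] /=.
- exact: linearP.
- exact: linearP.
rewrite !(koszul_homog _ hu) linearZ /= (koszul_homog _ hu) scalerA -exprD.
by congr (_ *: _); apply: (sign_absz_odd _ (a := Posz _)); lia.
Qed.

Lemma koszul1K V : involutive (@koszul k V 1).
Proof. by move=> v; rewrite koszulD (@koszul_parity _ _ 0 1) ?koszul0. Qed.

Lemma map_koszul_even V (e : nat) (s : seq V) : ~~ odd e -> map (koszul e%:Z) s = s.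
Proof.
move=> e_even; rewrite -[RHS]map_id; apply: eq_map => v.
by rewrite (@koszul_parity _ _ 0 e./2%:Z) ?koszul0 //; lia.
Qed.

(** In degree j both sides carry the sign (-1)^(j + e). *)
Lemma koszul1_hdeg V W e (f : {linear V -> W}) : hdeg e f ->
  forall v, koszul 1 (f v) = (-1) ^+ absz e *: f (koszul 1 v).
Proof.
move=> fe; apply: (@eq_on_homog _ _ (koszul 1 \o f) (_ \*: (f \o koszul 1))).
- exact: linearP.
- exact: linearP.
move=> j v hv /=; rewrite (koszul_homog _ hv) linearZ /= scalerA -exprD.
rewrite (koszul_homog _ (fe _ _ hv)); congr (_ *: _).
by apply: (sign_absz_odd _ (b := Posz _)); lia.
Qed.

End KoszulOperator.

(** * Sliding and contracting in lists *)

Section Lists.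
Variables (k : fieldType).

(** Stands for a family of linear maps on all tensor powers of V at once, as the length of the list
    is not fixed. *)
Definition multilin (V W : lmodType k) (phi : seq V -> W) :=
  forall s1 s2, linear (fun v => phi (s1 ++ v :: s2)).

Section Multilin.
Variables (V W : lmodType k).
Implicit Types (phi : seq V -> W).

Lemma multilin_cons phi v : multilin phi -> multilin (fun t => phi (v :: t)).
Proof. by move=> phiL s1 s2; apply: (phiL (v :: s1)). Qed.

Lemma multilin_head phi s : multilin phi -> linear (fun v => phi (v :: s)).
Proof. by move=> phiL; apply: (phiL [::]). Qed.

Lemma multilin_map (U : lmodType k) phi (g : {linear U -> V}) :
  multilin phi -> multilin (fun t => phi (map g t)).
Proof. by move=> phiL s1 s2 c u v; rewrite !map_cat /= linearP phiL. Qed.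

Lemma multilin0 phi s1 s2 : multilin phi -> phi (s1 ++ 0 :: s2) = 0.
Proof. by move=> phiL; apply: linear_fun0 (phiL s1 s2). Qed.

Lemma multilin0_head phi s : multilin phi -> phi (0 :: s) = 0.
Proof. exact: (@multilin0 _ [::]). Qed.

End Multilin.

Section Slide.
Variables (V : gradedType k) (f g : V -> V).
Implicit Types (W : lmodType k) (s : seq V).

(* [phi] composed with the sum of the id^r (x) f (x) g^t, for f of odd degree:
   the Koszul rule puts the sign operator on the first r arguments. *)
Fixpoint slide W (phi : seq V -> W) s : W :=
  if s is v :: s' then
    phi (f v :: map g s') + slide (fun t => phi (koszul 1 v :: t)) s'
  else 0.

Lemma eq_slide W (phi psi : seq V -> W) s :
  (forall t, size t = size s -> phi t = psi t) -> slide phi s = slide psi s.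
Proof.
elim: s phi psi => //= v s IH phi psi e; congr (_ + _).
  by rewrite e //= size_map.
by apply: IH => t ts; rewrite e //= ts.
Qed.

Lemma slideP W (c : k) (phi psi : seq V -> W) s :
  slide (fun t => c *: phi t + psi t) s = c *: slide phi s + slide psi s.
Proof.
elim: s phi psi => [|v s IH] phi psi /=; first by rewrite scaler0 addr0.
by rewrite IH scalerDr addrACA.
Qed.

Lemma slide0 W s : slide (fun=> 0 : W) s = 0.
Proof. by elim: s => //= v s ->; rewrite addr0. Qed.

Lemma slideD W (phi psi : seq V -> W) s :
  slide (fun t => phi t + psi t) s = slide phi s + slide psi s.
Proof.
rewrite -[slide phi s]scale1r -slideP.
by apply: eq_slide => t _; rewrite scale1r.
Qed.

Lemma slideZ W (c : k) (phi : seq V -> W) s :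
  slide (fun t => c *: phi t) s = c *: slide phi s.
Proof.
rewrite -[RHS]addr0 -(slide0 W s) -slideP.
by apply: eq_slide => t _; rewrite addr0.
Qed.

Lemma slide_sum W (I : Type) (r : seq I) (Q : pred I) (F : I -> seq V -> W) s :
  slide (fun t => \sum_(j <- r | Q j) F j t) s
  = \sum_(j <- r | Q j) slide (F j) s.
Proof.
elim: r => [|j r IH].
  by rewrite big_nil -[RHS](slide0 W s); apply: eq_slide => t _; rewrite big_nil.
rewrite big_cons -IH; case: ifP => Qj; rewrite -?slideD;
  by apply: eq_slide => t _; rewrite big_cons Qj.
Qed.

Lemma slide_comp W W' (L : W -> W') (phi : seq V -> W) s :
  linear L -> slide (fun t => L (phi t)) s = L (slide phi s).
Proof.
move=> LL; elim: s phi => [|v s IH] phi /=; first by rewrite linear_fun0.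
by rewrite IH linear_funD.
Qed.

(** If f hits one of the first j entries, g acts on all later ones; otherwise the sign operator acts
    on all of the first j. *)
Lemma slide_split W (Phi : seq V -> seq V -> W) j s :
  slide (fun t => Phi (take j t) (drop j t)) s
  = slide (fun t => Phi t (map g (drop j s))) (take j s)
    + slide (fun t => Phi (map (koszul 1) (take j s)) t) (drop j s).
Proof.
elim: s j Phi => [|v s IH] [|j] Phi; rewrite ?addr0 ?add0r //.
by rewrite /= -map_take -map_drop (IH _ (fun t => Phi (koszul 1 v :: t))) addrA.
Qed.

End Slide.

Section Contract.
Variables (V : lmodType k) (mu : V -> V -> V).
Implicit Types (W : lmodType k) (s : seq V).

(* [phi] composed with nu_n = sum of the (-1)^t id^r (x) mu (x) id^t. *)
Fixpoint contract W (phi : seq V -> W) s : W :=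
  if s is v :: s' then
    (if s' is w :: s'' then (-1) ^+ size s'' *: phi (mu v w :: s'') else 0)
    + contract (fun t => phi (v :: t)) s'
  else 0.

Lemma eq_contract W (phi psi : seq V -> W) s :
  (forall t, (size t).+1 = size s -> phi t = psi t) ->
  contract phi s = contract psi s.
Proof.
elim: s phi psi => //= v s IH phi psi e; congr (_ + _).
  by case: s e {IH} => // w s e; rewrite e.
by apply: IH => t ts; rewrite e //= ts.
Qed.

Lemma contractP W (c : k) (phi psi : seq V -> W) s :
  contract (fun t => c *: phi t + psi t) s
  = c *: contract phi s + contract psi s.
Proof.
elim: s phi psi => [|v s IH] phi psi /=; first by rewrite scaler0 addr0.
rewrite IH scalerDr addrACA; congr (_ + _); case: s {IH} => [|w s].
  by rewrite scaler0 addr0.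
by rewrite scalerDr !scalerA mulrC.
Qed.

Lemma contract0 W s : contract (fun=> 0 : W) s = 0.
Proof.
by elim: s => //= v [|w s] ->; rewrite addr0 // scaler0.
Qed.

Lemma contractD W (phi psi : seq V -> W) s :
  contract (fun t => phi t + psi t) s = contract phi s + contract psi s.
Proof.
rewrite -[contract phi s]scale1r -contractP.
by apply: eq_contract => t _; rewrite scale1r.
Qed.

Lemma contractZ W (c : k) (phi : seq V -> W) s :
  contract (fun t => c *: phi t) s = c *: contract phi s.
Proof.
rewrite -[RHS]addr0 -(contract0 W s) -contractP.
by apply: eq_contract => t _; rewrite addr0.
Qed.

Lemma contract_sum W (I : Type) (r : seq I) (Q : pred I) (F : I -> seq V -> W) s :
  contract (fun t => \sum_(j <- r | Q j) F j t) s
  = \sum_(j <- r | Q j) contract (F j) s.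
Proof.
elim: r => [|j r IH].
  rewrite big_nil -[RHS](contract0 W s).
  by apply: eq_contract => t _; rewrite big_nil.
rewrite big_cons -IH; case: ifP => Qj; rewrite -?contractD;
  by apply: eq_contract => t _; rewrite big_cons Qj.
Qed.

Lemma contract_comp W W' (L : W -> W') (phi : seq V -> W) s :
  linear L -> contract (fun t => L (phi t)) s = L (contract phi s).
Proof.
move=> LL; elim: s phi => [|v s IH] phi /=; first by rewrite linear_fun0.
rewrite IH linear_funD //; case: s {IH} => [|w s]; first by rewrite linear_fun0.
by rewrite linear_funZ.
Qed.

(** A product lands among the first j entries of the contracted list exactly when both factors are
    among the first j + 1 entries of s; the entries behind these contribute the extra sign. *)
Lemma contract_split W (Phi : seq V -> seq V -> W) j s :
  contract (fun t => Phi (take j t) (drop j t)) s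
  = (-1) ^+ size (drop j.+1 s)
      *: contract (fun t => Phi t (drop j.+1 s)) (take j.+1 s)
    + contract (fun t => Phi (take j s) t) (drop j s).
Proof.
elim: s j Phi => [|v s IH] [|j] Phi; rewrite ?scaler0 ?addr0 //.
  rewrite [take 1 _]/= take0 [X in _ *: X]/= addr0 scaler0 add0r.
  by apply: eq_contract => t _; rewrite !take0 !drop0.
rewrite [LHS]/= (IH _ (fun t1 t2 => Phi (v :: t1) t2)) addrA; congr (_ + _).
rewrite /= scalerDr; congr (_ + _); case: s {IH} => [|w s] /=.
  by rewrite scaler0.
rewrite scalerA -exprD -size_cat; congr (_ *: _).
by rewrite size_cat addnC -size_cat cat_take_drop.
Qed.

Lemma multilin_contract W (phi : seq V -> W) :
  (forall w, linear (mu^~ w)) -> (forall v, linear (mu v)) ->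
  multilin phi -> multilin (contract phi).
Proof.
move=> muL muR phiL s1; elim: s1 phi phiL => [|x s1 IH] phi phiL s2 c u v /=.
  rewrite scalerDr addrACA -contractP; congr (_ + _).
    case: s2 => [|w s2]; first by rewrite scaler0 addr0.
    by rewrite muL (multilin_head _ phiL) scalerDr !scalerA mulrC.
  by apply: eq_contract => t _; rewrite (multilin_head _ phiL).
rewrite scalerDr addrACA (IH _ (multilin_cons _ phiL)); congr (_ + _).
case: s1 {IH} => [|w s1] /=.
  by rewrite muR (multilin_head _ phiL) scalerDr !scalerA mulrC.
rewrite !size_cat /= (phiL (mu x w :: s1)) scalerDr !scalerA mulrC.
by [].
Qed.

(* The two ways of contracting three consecutive factors come with opposite
   signs, and so do the two orders of two disjoint contractions. *)
Lemma contract_contract W (phi : seq V -> W) s :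
  (forall u v w, mu (mu u v) w = mu u (mu v w)) ->
  contract (contract phi) s = 0.
Proof.
move=> muA; elim: s phi => // u [|v s] IH phi; first by rewrite /= !addr0.
have -> : contract (contract phi) [:: u, v & s] =
    (-1) ^+ size s *: contract phi (mu u v :: s)
    + contract (fun t => contract phi (u :: t)) (v :: s) by [].
rewrite contractD IH addr0; case: s {IH} => [|w s].
  by rewrite /= !addr0 scaler0.
rewrite /= muA; set X := contract _ s; set Y := contract _ s.
have -> : Y = (-1) ^+ size s *: X.
  by rewrite -contractZ; apply: eq_contract => t <-.
set x := match s with [::] => _ | _ :: _ => _ end.
set y := match s with [::] => _ | _ :: _ => _ end.
have -> : y = (-1) ^+ size s *: x.
  rewrite {}/x {}/y; case: (s) => [|z t]; first by rewrite scaler0.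
  by rewrite !scalerA mulrC.
by rewrite -!scalerDr exprS mulN1r scaleNr addNr.
Qed.

End Contract.

(** * Composites of slides and contractions *)

Section SlideComposites.
Variables (V : gradedType k) (W : lmodType k).
Implicit Types (s : seq V) (phi : seq V -> W).

(** The scalar c allows r to commute with f only up to sign; it comes out once because every summand
    contains f once. *)
Lemma slide_map (U : gradedType k) (c : k) (f g : U -> U) (f' g' : V -> V)
    (r : U -> V) phi (s : seq U) :
  (forall v, r (f v) = c *: f' (r v)) -> (forall v, r (g v) = g' (r v)) ->
  (forall v, r (koszul 1 v) = koszul 1 (r v)) -> multilin phi ->
  slide f g (fun t => phi (map r t)) s = c *: slide f' g' phi (map r s).
Proof.
move=> rf rg rk; elim: s phi => [|v s IH] phi phiL /=; first by rewrite scaler0.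
rewrite rf (linear_funZ _ _ (multilin_head _ phiL)) scalerDr rk.
rewrite (IH _ (multilin_cons _ phiL)) -!map_comp.
by under eq_map => u do rewrite /= rg.
Qed.

Lemma slide_map_eq0 (U : lmodType k) (f g : V -> V) (r : V -> U)
    (phi : seq U -> W) s :
  (forall v, r (f v) = 0) -> multilin phi ->
  slide f g (fun t => phi (map r t)) s = 0.
Proof.
move=> rf; elim: s phi => //= v s IH phi phiL.
by rewrite rf (multilin0_head _ phiL) add0r (IH _ (multilin_cons _ phiL)).
Qed.

Lemma slide_on_map_eq0 (U : lmodType k) (f g : V -> V) (r : U -> V) phi (s : seq U) :
  (forall v, f (r v) = 0) -> multilin phi -> slide f g phi (map r s) = 0.
Proof.
move=> fr; elim: s phi => //= v s IH phi phiL.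
by rewrite fr (multilin0_head _ phiL) add0r (IH _ (multilin_cons _ phiL)).
Qed.

(** Each term of the double sum has a slot containing f f, f g or g f, according to whether the two
    positions of f agree and, if not, to their order. *)
Lemma slide_slide (f g : V -> V) phi s :
  (forall v, f (f v) = 0) -> (forall v, f (g v) = 0) -> (forall v, g (f v) = 0) ->
  multilin phi -> slide f g (slide f g phi) s = 0.
Proof.
move=> ff fg gf; elim: s phi => //= v s IH phi phiL.
rewrite slideD ff (multilin0_head _ phiL) add0r.
rewrite (slide_on_map_eq0 _ _ fg (multilin_cons _ phiL)) add0r.
rewrite (slide_map_eq0 _ _ gf (multilin_cons _ phiL)) add0r.
exact: (IH (fun t => phi (koszul 1 (koszul 1 v) :: t)) (multilin_cons _ phiL)).
Qed.

(* The tensor trick: a homotopy from g to the identity induces one from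
   g^{(x) n} to the identity. *)
Lemma slide_homotopy (d h g : {linear V -> V}) phi s :
  (forall v, koszul 1 (d v) = - d (koszul 1 v)) ->
  (forall v, koszul 1 (h v) = - h (koszul 1 v)) ->
  (forall v, koszul 1 (g v) = g (koszul 1 v)) ->
  (forall v, d (g v) = g (d v)) ->
  (forall v, v - g v = d (h v) + h (d v)) -> multilin phi ->
  slide d id (slide h g phi) s + slide h g (slide d id phi) s
  = phi s - phi (map g s).
Proof.
move=> kd kh kg dg htpy; elim: s phi => [|v s IH] phi phiL /=.
  by rewrite addr0 subrr.
rewrite !slideD !map_id kd kh !koszul1K.
have phi1 u := multilin_cons u phiL.
(* As d commutes with g, the tail can be mapped by g beforehand. *)
have gE : slide d id (fun t => phi (h (koszul 1 v) :: map g t)) s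
   = slide d id (fun t => phi (h (koszul 1 v) :: t)) (map g s).
  rewrite -[RHS]scale1r; apply: (@slide_map _ 1 d id d id g) => // u.
  by rewrite -dg scale1r.
have E1 : slide d id (fun t => phi (- h (koszul 1 v) :: t)) (map g s)
   = - slide d id (fun t => phi (h (koszul 1 v) :: t)) (map g s).
  rewrite -scaleN1r -slideZ; apply: eq_slide => t _.
  by rewrite (linear_funN _ (multilin_head _ phiL)) scaleN1r.
have E2 : slide h g (fun t => phi (- d (koszul 1 v) :: t)) s
   = - slide h g (fun t => phi (d (koszul 1 v) :: t)) s.
  rewrite -scaleN1r -slideZ; apply: eq_slide => t _.
  by rewrite (linear_funN _ (multilin_head _ phiL)) scaleN1r.
have E3 : slide h g (fun t => phi (d (koszul 1 v) :: map id t)) s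
   = slide h g (fun t => phi (d (koszul 1 v) :: t)) s.
  by apply: eq_slide => t _; rewrite map_id.
rewrite gE E1 E2 E3; have /= := IH _ (phi1 v).
have phiLh := multilin_head (map g s) phiL.
have : phi (v - g v :: map g s) = phi (d (h v) :: map g s) + phi (h (d v) :: map g s).
  by rewrite htpy (linear_funD _ _ phiLh).
rewrite (linear_funD _ _ phiLh) (linear_funN _ phiLh).
set a := phi (v :: _); set b := phi (g v :: _); set c := phi (d _ :: _).
set e := phi (h _ :: _); set X := slide d id (slide _ _ _) _.
set Y := slide h g (slide _ _ _) _; set p := slide d id _ _.
set q := slide h g _ _ => abE XYE.
(* The mixed terms, with one of d and h on the head and the other on the tail, cancel because both
   maps are odd. The head contributes (id - g) (x) g^n and the induction hypothesis id (x) (id -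
   g^n), which telescope. *)
rewrite addrACA (addrACA e) (addrACA p) -addrA (addrA (- q - p)) -opprD.
by rewrite (addrC p) addNr add0r XYE [e + c]addrC -abE addrC addrA subrK.
Qed.

(** On the contracted pair this is the Leibniz rule; elsewhere d and mu act on disjoint slots, and
    the sign operator is multiplicative. *)
Lemma contract_slide (d : V -> V) (mu : V -> V -> V) phi s :
  (forall v w, d (mu v w) = mu (d v) w + mu (koszul 1 v) (d w)) ->
  (forall v w, koszul 1 (mu v w) = mu (koszul 1 v) (koszul 1 w)) ->
  multilin phi ->
  contract mu (slide d id phi) s = slide d id (contract mu phi) s.
Proof.
move=> dmu kmu; elim: s phi => // v s IH phi phiL.
have -> : contract mu (slide d id phi) (v :: s) =
    (if s is w :: t then (-1) ^+ size t *: slide d id phi (mu v w :: t) else 0)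
    + contract mu (fun t => slide d id phi (v :: t)) s by [].
have -> : slide d id (contract mu phi) (v :: s)
    = contract mu phi (d v :: s)
      + slide d id (fun t => contract mu phi (koszul 1 v :: t)) s.
  by rewrite /= map_id.
rewrite [contract mu phi (d v :: s)]/= slideD contractD.
rewrite (IH _ (multilin_cons _ phiL)) /=.
rewrite !addrA; congr (_ + _).
under eq_contract => t _ do rewrite map_id.
rewrite [RHS]addrAC; congr (_ + _).
case: s {IH} => [|w t] /=; first by rewrite addr0.
rewrite !map_id dmu kmu (linear_funD _ _ (multilin_head _ phiL)) !scalerDr.
rewrite -!addrA; do 2!congr (_ + _).
by rewrite -slideZ; apply: eq_slide => u ->.
Qed.

End SlideComposites.

(** * Sums over compositions *)

Section BlockSum.
Variables (V : gradedType k) (U : lmodType k) (P : seq V -> U).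
Implicit Types (W : lmodType k) (s : seq V).

(* [psi] composed with the signed sum of the P_(i_1) (x) ... (x) P_(i_r) over
   the compositions of [size s] into r positive parts. The exponent e has the
   parity of the degree (i_2 - 1) + ... + (i_r - 1) of the last r - 1 factors. *)
Fixpoint blocksum W (r : nat) (psi : seq U -> W) s : W :=
  if r is r'.+1 then
    \sum_(1 <= j < (size s).+1) (let e := (size (drop j s) + r')%N in
      (-1) ^+ (e * j) *:
        blocksum r' (fun t => psi (P (map (koszul e%:Z) (take j s)) :: t))
          (drop j s))
  else if s is [::] then psi [::] else 0.

Lemma blocksumP W r (c : k) (psi psi' : seq U -> W) s :
  blocksum r (fun t => c *: psi t + psi' t) s
  = c *: blocksum r psi s + blocksum r psi' s.
Proof.
elim: r psi psi' s => [|r IH] psi psi' s /=.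
  by case: s => // *; rewrite scaler0 addr0.
rewrite scaler_sumr -big_split; apply: eq_bigr => j _ /=.
by rewrite IH scalerDr !scalerA mulrC.
Qed.

Lemma eq_blocksum W r (psi psi' : seq U -> W) s :
  psi =1 psi' -> blocksum r psi s = blocksum r psi' s.
Proof.
elim: r psi psi' s => [|r IH] psi psi' s e /=; first by rewrite e.
by apply: eq_bigr => j _; congr (_ *: _); apply: IH => t; rewrite e.
Qed.

Lemma blocksum_head_linear W r (psi : seq U -> W) s :
  multilin psi -> linear (fun y => blocksum r (fun t => psi (y :: t)) s).
Proof.
move=> psiL c y z; rewrite -blocksumP; apply: eq_blocksum => t.
exact: (multilin_head t psiL).
Qed.

Lemma blocksum_small W r (psi : seq U -> W) s :
  (size s < r)%N -> blocksum r psi s = 0.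
Proof.
elim: r psi s => // r IH psi s lt_sr /=; rewrite big_nat big1 // => j /andP[j1 js].
by rewrite IH ?scaler0 // size_drop; lia.
Qed.

Lemma multilin_blocksum W r (psi : seq U -> W) :
  multilin P -> multilin psi -> multilin (blocksum r psi).
Proof.
move=> PL; elim: r psi => [|r IH] psi psiL s1 s2 c u v.
  by case: s1 => * /=; rewrite scaler0 addr0.
rewrite /= !size_cat /= scaler_sumr -big_split; apply: eq_bigr => j _ /=.
rewrite !size_drop !size_cat /=; set e := (_ + r)%N.
rewrite scalerA [c * _]mulrC -scalerA -scalerDr; congr (_ *: _).
(* The varying entry lies behind the first block, with some entry in between or directly after it,
   or else inside the first block. *)
rewrite !take_cat !drop_cat; have [lt_j|le_j] := ltnP j (size s1).
  exact: IH (multilin_cons _ psiL) _ _ _ _ _.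
case: (j - size s1)%N => [|l] /=.
  exact: (IH _ (multilin_cons _ psiL) [::]).
rewrite -(blocksum_head_linear _ _ psiL).
by rewrite (multilin_map (koszul e%:Z) PL).
Qed.

(** * Block sums of a family with P_n = (-1)^n P_(n-1) N h *)

Section Resolution.
Variables (p : V -> U) (h g : V -> V) (mu : V -> V -> V).
Hypotheses (PL : multilin P) (P1 : forall v, P [:: v] = p v).
Hypotheses (muL : forall w, linear (mu^~ w)) (muR : forall v, linear (mu v)).
Hypotheses (kh : forall v, koszul 1 (h v) = - h (koszul 1 v))
  (kg : forall v, koszul 1 (g v) = g (koszul 1 v))
  (hh : forall v, h (h v) = 0) (hg : forall v, h (g v) = 0)
  (gh : forall v, g (h v) = 0) (ph : forall v, p (h v) = 0)
  (pg : forall v, p (g v) = p v).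
Hypothesis (Prec : forall s, (1 < size s)%N ->
  P s = (-1) ^+ size s *: slide h g (contract mu P) s).
Local Notation hs := (slide h g).
Local Notation ns := (contract mu).

Lemma blocksum_diag W r (psi : seq U -> W) s :
  size s = r -> blocksum r psi s = psi (map p s).
Proof.
elim: r psi s => [|r IH] psi [|v s] //= [sr].
(* A first block longer than 1 leaves fewer entries than blocks. For length 1 the exponent is r + r,
   so all signs are trivial. *)
rewrite big_ltn // big_nat big1 => [|j /andP[j1 js]]; last first.
  by rewrite blocksum_small ?scaler0 // size_drop /=; lia.
rewrite /= drop0 take0 sr IH // addr0 muln1 -signr_odd addnn odd_double.
by rewrite scale1r /= (@koszul_parity _ _ _ 0 r) ?koszul0 ?P1 //; lia.
Qed.

(** Up to sign phi begins by applying h_n to its arguments, and h_n h_n = 0. *)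
Lemma slide_resolved W (phi : seq V -> W) s :
  (1 < size s)%N -> multilin phi ->
  (forall t, size t = size s ->
     phi t = (-1) ^+ size s *: hs (ns phi) t) ->
  hs phi s = 0.
Proof.
move=> s1 phiL phiE; rewrite (eq_slide _ _ phiE) slideZ slide_slide ?scaler0 //.
exact: multilin_contract.
Qed.

Lemma slide_P s : hs P s = 0.
Proof.
have [s1|] := ltnP 1 (size s).
  by apply: slide_resolved => // t ts; rewrite Prec ?ts.
case: s => [|v [|//]] _ //=; by rewrite addr0 P1 ph.
Qed.

(** By parity the operator is the identity or the one of exponent 1, which commutes with g and
    anticommutes with h; so P_n h_n = 0 carries over. *)
Lemma slide_P_koszul e s : hs (fun t => P (map (koszul e) t)) s = 0.
Proof.
pose b := odd (absz e).
have kE u : koszul e u = (if b then koszul 1 u else u) :> V.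
  rewrite /b; case: ifP => eb.
    by apply: (@koszul_parity _ _ _ _ ((e - 1) %/ 2)%Z); lia.
  by rewrite (@koszul_parity _ _ _ 0 (e %/ 2)%Z) ?koszul0 //; lia.
rewrite (@slide_map _ _ _ (if b then -1 else 1) h g h g) => [||v|v|] //.
- by rewrite slide_P scaler0.
- by move=> v; rewrite !kE; case: (b); rewrite ?scale1r ?scaleN1r.
- by rewrite !kE; case: (b); rewrite ?kg.
- by rewrite !koszulD addrC.
Qed.

(** A contraction leaves fewer entries than blocks or, for r = 0, at least one entry that no block
    takes. *)
Lemma contract_blocksum0 W r (psi : seq U -> W) s :
  (size s <= r)%N \/ r = 0 -> ns (blocksum r psi) s = 0.
Proof.
move=> rs; case: s rs => // v s rs.
case: s rs => [|w s] rs; first by rewrite /= addr0.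
rewrite -[RHS](contract0 mu W [:: v, w & s]); apply: eq_contract => t [ts].
case: rs => [rs|->]; first by rewrite blocksum_small // ts.
by case: t ts.
Qed.

(** Named because the lemmas up to [blocksum_rec] use it as the induction hypothesis on r. *)
Definition blocksum_recurrence W r :=
  forall (psi : seq U -> W) s, multilin psi -> (r < size s)%N ->
  blocksum r psi s = (-1) ^+ size s *: hs (ns (blocksum r psi)) s.

Lemma slide_blocksum W r (psi : seq U -> W) s :
  blocksum_recurrence W r -> multilin psi -> hs (blocksum r psi) s = 0.
Proof.
move=> IH psiL; have [rs|sr|rs] := ltngtP r (size s).
(* [slide_resolved] asks for two entries, so r = 0 is separate: there the block sum vanishes on
   nonempty lists. *)
- case: r rs IH => [|r] rs IH.
    rewrite -[RHS](slide0 h g W s); apply: eq_slide => t ts.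
    by case: t ts rs => //= <-.
  apply: slide_resolved; first exact: leq_trans rs.
    exact: multilin_blocksum.
  by move=> t ts; rewrite IH ?ts.
- rewrite -[RHS](slide0 h g W s); apply: eq_slide => t ts.
  by rewrite blocksum_small ?ts.
- rewrite -(slide_map_eq0 g s ph psiL); apply: eq_slide => t ts.
  by rewrite blocksum_diag ?ts.
Qed.

(** For r below the length the recurrence produces h_n g^{(x) n} = 0; for r equal to it, p g = p. *)
Lemma blocksum_on_map W r (psi : seq U -> W) s :
  blocksum_recurrence W r -> multilin psi ->
  blocksum r psi (map g s) = if size s == r then psi (map p s) else 0.
Proof.
move=> IH psiL; have [sr|rs|rs] := ltngtP (size s) r.
- by rewrite blocksum_small ?size_map.
- rewrite IH ?size_map // slide_on_map_eq0 ?scaler0 //.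
  by apply: multilin_contract => //; apply: multilin_blocksum.
- rewrite blocksum_diag ?size_map // -map_comp; congr psi.
  by apply: eq_map => v /=; rewrite pg.
Qed.

Lemma slide_contract_P s : (1 < size s)%N -> hs (ns P) s = (-1) ^+ size s *: P s.
Proof.
by move=> s1; rewrite Prec // scalerA -exprD signr_even ?scale1r // addnn odd_double.
Qed.

(* (-1)^n R nu_n h_n = R for R the r-fold block sum. Of the terms of the left
   hand side only those contracting the last block of length at least 2 survive,
   the others contain some h_m h_m, h_m (ip)^{(x) m} or p h. *)
Lemma blocksum_rec W r : blocksum_recurrence W r.
Proof.
elim: r => [|r IH] psi s psiL lt_rs.
  have -> : hs (ns (blocksum 0 psi)) s = 0.
    rewrite -[RHS](slide0 h g W s); apply: eq_slide => t ts.
    by rewrite contract_blocksum0 //; right.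
  by rewrite scaler0; case: s lt_rs.
set n := size s in lt_rs *.
(* Summands are sorted by the length j of the first block: [T j] on s itself, [Phi j] on a list with
   one entry less, already cut behind the first block. *)
pose T j := (-1) ^+ ((n - j + r) * j) *:
  blocksum r (fun t => psi (P (map (koszul (n - j + r)%N%:Z) (take j s)) :: t))
    (drop j s).
pose Phi j (t1 t2 : seq V) := (-1) ^+ ((size t2 + r) * j) *:
  blocksum r (fun t => psi (P (map (koszul (size t2 + r)%N%:Z) t1) :: t)) t2.
have nsE t : size t = n -> ns (blocksum r.+1 psi) t
    = \sum_(1 <= j < n) ns (fun u => Phi j (take j u) (drop j u)) t.
  move=> tn; rewrite -contract_sum; apply: eq_contract => u; rewrite tn => un.
  by rewrite /= un.
(* Contracting inside the first block gives a contribution only if exactly r entries remain behind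
   it, one for each other block; contracting behind it reproduces [T j] by induction. *)
have termE j : (1 <= j < n)%N ->
    hs (ns (fun u => Phi j (take j u) (drop j u))) s
    = (-1) ^+ n *: ((if (j.+1 == n - r)%N then T (n - r)%N else 0)
                    + (if (r < n - j)%N then T j else 0)).
  move=> jn; pose d := drop j s; pose d1 := drop j.+1 s.
  have sd : size d = (n - j)%N by rewrite size_drop.
  have sd1 : size d1 = (n - j.+1)%N by rewrite size_drop.
  have [n_gt0 j_gt0] : (0 < n)%N /\ (0 < j)%N by lia.
  have Lin t2 := blocksum_head_linear r t2 psiL.
  (* [Psi1] contracts inside the first block, which then uses j + 1 entries of s; [Psi2] contracts
     behind it. Splitting h_n at the same place gives four pieces. *)
  pose Psi1 (t1 t2 : seq V) :=
    (-1) ^+ size t2 *: ns (fun t => Phi j t t2) t1.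
  pose Psi2 (t1 t2 : seq V) := ns (fun t => Phi j t1 t) t2.
  have -> : hs (ns (fun u => Phi j (take j u) (drop j u))) s
    = hs (fun t => Psi1 (take j.+1 t) (drop j.+1 t)) s
      + hs (fun t => Psi2 (take j t) (drop j t)) s.
    by rewrite -slideD; apply: eq_slide => t _; rewrite contract_split.
  have Psi1E t1 t2 : Psi1 t1 t2 =
      (-1) ^+ size t2 *: ((-1) ^+ ((size t2 + r) * j) *: blocksum r (fun t =>
        psi (ns (fun u => P (map (koszul (size t2 + r)%N%:Z) u)) t1 :: t)) t2).
    rewrite /Psi1 contractZ; congr (_ *: (_ *: _)).
    exact: (contract_comp _ _ _ (Lin t2)).
  have Psi2E t1 t2 : (0 < size t2)%N -> Psi2 t1 t2 =
      (-1) ^+ (((size t2).-1 + r) * j) *: ns (blocksum r (fun t =>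
        psi (P (map (koszul ((size t2).-1 + r)%N%:Z) t1) :: t))) t2.
    move=> t2_gt0; rewrite -contractZ; apply: eq_contract => t tt2.
    by rewrite /Phi -tt2.
  rewrite !slide_split -/d -/d1.
  (* Here h meets the r-fold block sum of the rest directly. *)
  have -> : hs (fun t => Psi1 (map (koszul 1) (take j.+1 s)) t) d1 = 0.
    set a := map _ _.
    rewrite (eq_slide _ _ (psi := fun t => (-1) ^+ size d1 *:
      ((-1) ^+ ((size d1 + r) * j) *: blocksum r (fun t =>
        psi (ns (fun u => P (map (koszul (size d1 + r)%N%:Z) u)) a :: t)) t))).
      rewrite !slideZ slide_blocksum ?scaler0 //; exact: multilin_cons.
    by move=> t td; rewrite Psi1E td.
  (* Here h meets the uncontracted first block, and P_j h_j = 0. *)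
  have -> : hs (fun t => Psi2 t (map g d)) (take j s) = 0.
    rewrite (eq_slide _ _ (psi := fun t => (-1) ^+ (((size d).-1 + r) * j) *:
      ns (blocksum r (fun u => psi (P (map (koszul ((size d).-1 + r)%N%:Z) t) :: u)))
        (map g d))).
      have LL : linear (fun y => ns (blocksum r (fun u => psi (y :: u))) (map g d)).
        by move=> c y z; rewrite -contractP; apply: eq_contract => u _; rewrite Lin.
      rewrite slideZ; have /= -> := slide_comp h g
        (fun t => P (map (koszul ((size d).-1 + r)%N%:Z) t)) (take j s) LL.
      by rewrite slide_P_koszul (linear_fun0 LL) scaler0.
    by move=> t _; rewrite Psi2E size_map // sd; lia.
  rewrite addr0 add0r scalerDr; congr (_ + _).
    (* With g on the rest, its block sum is zero unless the rest has r entries, when it becomes p on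
       each of them. *)
    have -> : hs (fun t => Psi1 t (map g d1)) (take j.+1 s) =
        if size d1 == r then (-1) ^+ r *:
          psi (hs (ns P) (take j.+1 s) :: map p d1) else 0.
      have LL := multilin_head (map p d1) psiL.
      case: ifP => d1r.
        rewrite -(slide_comp _ _ _ _ LL) -slideZ; apply: eq_slide => t _.
        rewrite Psi1E size_map (eqP d1r).
        rewrite (signr_even _ (n := (r + r) * j)); last by lia.
        rewrite scale1r.
        rewrite blocksum_on_map ?d1r; [|exact: IH|exact: multilin_cons].
        congr (_ *: psi (_ :: _)); apply: eq_contract => u _; congr P.
        by rewrite map_koszul_even //; lia.
      rewrite -[RHS](slide0 h g _ (take j.+1 s)); apply: eq_slide => t _.
      rewrite Psi1E size_map blocksum_on_map ?d1r ?scaler0 //.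
      exact: multilin_cons.
    rewrite sd1; case: ifP; case: ifP; [|lia|lia|by rewrite scaler0].
    move=> /eqP jr _; rewrite slide_contract_P size_takel -/n; [|lia..].
    rewrite (linear_funZ _ _ (multilin_head _ psiL)) scalerA -exprD.
    rewrite /T -jr -/d1 blocksum_diag; last by rewrite sd1; lia.
    rewrite (signr_even _ (n := (n - j.+1 + r) * j.+1)); last by lia.
    rewrite scale1r map_koszul_even; last by lia.
    by congr (_ *: _); congr (_ ^+ _); lia.
  have -> : hs (fun t => Psi2 (map (koszul 1) (take j s)) t) d
      = (-1) ^+ (((n - j).-1 + r) * j) *: hs (ns (blocksum r (fun t =>
        psi (P (map (koszul (n - j + r)%N%:Z) (take j s)) :: t)))) d.
    rewrite -slideZ; apply: eq_slide => t; rewrite sd => td.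
    rewrite Psi2E td; last by lia.
    rewrite -map_comp; congr (_ *: _); apply: eq_contract => u _.
    apply: eq_blocksum => w; congr (psi (P _ :: _)); apply: eq_map => v /=.
    by rewrite koszulD; congr (koszul _ v); lia.
  case: ifP => rnj; last first.
    rewrite scaler0 [hs _ _](_ : _ = 0) ?scaler0 //.
    rewrite -[RHS](slide0 h g W d); apply: eq_slide => t td.
    by rewrite contract_blocksum0 // td sd leqNgt rnj; left.
  (* The induction hypothesis applies to the entries behind the first block; a comparison of signs
     is left. *)
  rewrite /T IH ?sd; [|exact: multilin_cons|by []].
  rewrite !scalerA -!exprD; congr (_ *: _); apply: signr_parity.
  have [a nja] : exists a, (n - j = a.+1)%N by exists (n - j).-1; lia.
  have -> : n = (a.+1 + j)%N by lia.
  rewrite addnK /= !oddD !oddM !oddD /=.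
  by case: (odd a) (odd j) (odd r) => [] [] [].
have BE : blocksum r.+1 psi s = \sum_(1 <= j < n.+1) T j.
  by apply: eq_bigr => j _ /=; rewrite size_drop.
rewrite [LHS]BE (eq_slide _ _ nsE) slide_sum (eq_big_nat _ _ termE).
rewrite -scaler_sumr scalerA -exprD -signr_odd addnn odd_double scale1r.
rewrite big_split /= -!big_mkcond /=.
(* The index n - r - 1 is at least 1, since r + 1 < n. *)
have -> : \sum_(1 <= j < n | j.+1 == (n - r)%N) T (n - r)%N = T (n - r)%N.
  rewrite (eq_bigl (fun j => j == (n - r).-1)) => [|j]; last by lia.
  by rewrite big_nat1_eq; case: ifP => //; lia.
have -> : \sum_(1 <= j < n | (r < n - j)%N) T j = \sum_(1 <= j < n - r) T j.
  rewrite [RHS](big_nat_widen _ _ n) ?leq_subr //.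
  by apply: eq_bigl => j /=; lia.
(* In the full block sum, a first block longer than n - r leaves fewer than r entries, so those
   terms vanish. *)
rewrite (big_cat_nat _ (n := (n - r)%N)) /=; [|lia..].
rewrite [X in _ + X]big_ltn; last lia.
rewrite [X in _ + (_ + X)](_ : _ = 0) ?addr0 1?addrC //.
rewrite big_nat big1 // => j /andP[rj jn].
by rewrite /T blocksum_small ?scaler0 // size_drop -/n; lia.
Qed.

End Resolution.
End BlockSum.
End Lists.

(** * The recursion of both sides *)

Section MorphismEquation.
Variables (k : fieldType) (V : gradedType k) (U : lmodType k).
Variables (P : seq V -> U) (M : seq U -> U) (p : V -> U).
Variables (d h g : {linear V -> V}) (mu : V -> V -> V).
Hypotheses (PL : multilin P) (ML : multilin M) (P1 : forall v, P [:: v] = p v).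
Hypotheses (muL : forall w, linear (mu^~ w)) (muR : forall v, linear (mu v))
  (muA : forall u v w, mu (mu u v) w = mu u (mu v w))
  (dmu : forall v w, d (mu v w) = mu (d v) w + mu (koszul 1 v) (d w))
  (kmu : forall v w, koszul 1 (mu v w) = mu (koszul 1 v) (koszul 1 w)).
Hypotheses (kd : forall v, koszul 1 (d v) = - d (koszul 1 v))
  (kh : forall v, koszul 1 (h v) = - h (koszul 1 v))
  (kg : forall v, koszul 1 (g v) = g (koszul 1 v))
  (dg : forall v, d (g v) = g (d v))
  (htpy : forall v, v - g v = d (h v) + h (d v))
  (hh : forall v, h (h v) = 0) (hg : forall v, h (g v) = 0)
  (gh : forall v, g (h v) = 0) (ph : forall v, p (h v) = 0)
  (pg : forall v, p (g v) = p v) (pd : forall v, p (d v) = 0).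
Hypothesis (Prec : forall s, (1 < size s)%N ->
  P s = (-1) ^+ size s *: slide h g (contract mu P) s).
Hypotheses (M1 : forall u, M [:: u] = 0)
  (MP : forall s, (1 < size s)%N -> contract mu P (map g s) = M (map p s)).
Local Notation hs := (slide h g).
Local Notation ds := (slide d id).
Local Notation ns := (contract mu).

(** The left side of the morphism equation when only m_1 = d and m_2 = mu are nonzero: for m_1 the
    sign exponent r + t is n - 1, for m_2 the sign (-1)^t is part of [contract]. *)
Definition morphism_lhs s := (-1) ^+ (size s).-1 *: ds P s + ns P s.
Definition morphism_rhs s := \sum_(1 <= r < (size s).+1) blocksum P r M s.

Lemma morphism_lhs_rec s : (1 < size s)%N ->
  morphism_lhs s = M (map p s) + (-1) ^+ size s *: hs (ns morphism_lhs) s.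
Proof.
move=> s1.
have dsP : ds P s = (-1) ^+ size s *: ds (hs (ns P)) s.
  by rewrite -slideZ; apply: eq_slide => t ts; rewrite Prec ts.
(* The part P_(n-2) N N vanishes by associativity, and D commutes with N. *)
have nsL t : size t = size s -> ns morphism_lhs t = (-1) ^+ size s *: ds (ns P) t.
  move=> ts; rewrite -contract_slide // -contractZ -[RHS]addr0.
  rewrite -(contract_contract P t muA) -contractD; apply: eq_contract => u ut.
  rewrite /morphism_lhs; congr (_ *: _ + _); apply: signr_parity.
  by move: s1; rewrite -ts -ut; case: (size u) => //= m _; rewrite negbK.
(* The tensor trick is applied to P_(n-1) N; its g part is m_n p^{(x) n}. *)
have := slide_homotopy s kd kh kg dg htpy (multilin_contract muL muR PL).
rewrite (eq_slide _ _ nsL) slideZ scalerA -exprD signr_even ?scale1r; last by lia.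
move=> E; rewrite /morphism_lhs dsP scalerA -exprD (@signr_parity _ _ 1); last by lia.
rewrite expr1 scaleN1r -MP // -[ns P s](subrK (ns P (map g s))) -E.
by rewrite addrA addKr addrC.
Qed.

Lemma morphism_rhs_rec s : (1 < size s)%N ->
  morphism_rhs s = M (map p s) + (-1) ^+ size s *: hs (ns morphism_rhs) s.
Proof.
(* The summand r = n has only blocks of length 1 and equals m_n p^{(x) n}; each summand r < n
   satisfies the recursion by itself. *)
move=> s1; rewrite [LHS]/morphism_rhs big_nat_recr ?(ltnW s1) //= [LHS]addrC.
rewrite (blocksum_diag P1) //; congr (_ + _).
have nsR t : size t = size s -> ns morphism_rhs t
   = \sum_(1 <= r < size s) ns (blocksum P r M) t.
  by move=> ts; rewrite -contract_sum; apply: eq_contract => u; rewrite ts => <-.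
rewrite (eq_slide _ _ nsR) slide_sum scaler_sumr; apply: eq_big_nat => r /andP[r1 rs].
by apply: (blocksum_rec PL P1 muL muR kh kg hh hg gh ph pg Prec).
Qed.

(** Both sides obey the same recursion on the length, and on one entry they vanish by p d = 0 and
    m_1 = 0. *)
Lemma morphism_eq s : (0 < size s)%N -> morphism_lhs s = morphism_rhs s.
Proof.
move: {-1}(size s) (erefl (size s)) => n; elim: n s => // n IH s sn _.
case: n IH sn => [|n] IH sn.
  case: s sn => [|v [|//]] // _; rewrite /morphism_lhs /morphism_rhs /= expr0 scale1r.
  by rewrite !addr0 P1 pd big_nat1 (blocksum_diag P1) //= M1.
rewrite morphism_lhs_rec ?morphism_rhs_rec ?sn //; congr (_ + _ *: _).
apply: eq_slide => t ts; apply: eq_contract => u ut; apply: IH => //.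
by apply: succn_inj; rewrite ut ts -sn.
Qed.

End MorphismEquation.

(** * Tensor powers as lists *)

Section TensorsAsLists.
Variables (k : fieldType).

Lemma codom_seq (V : lmodType k) n (s : seq V) :
  size s = n -> codom [ffun i : 'I_n => s`_i] = s.
Proof.
move=> sn; apply: (@eq_from_nth _ 0) => [|j]; rewrite size_codom card_ord ?sn // => jn.
rewrite /codom /image_mem (nth_map (Ordinal jn)) ?size_enum_ord // ffunE.
by rewrite (nth_ord_enum _ (Ordinal jn)).
Qed.

Lemma tpure_codom (V : lmodType k) n (a : {ffun 'I_n -> V}) :
  tpure a = tprod n (codom a).
Proof.
congr tpure; apply/ffunP => j; rewrite ffunE /codom /image_mem.
by rewrite (nth_map j) ?size_enum_ord // nth_ord_enum.
Qed.

(** Pure tensors span. The linear structures are packed from the proofs of linearity. *)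
Lemma tens_tprod_ext (V W : lmodType k) n (f f' : tens n V -> W) :
  linear f -> linear f' ->
  (forall s, size s = n -> f (tprod n s) = f' (tprod n s)) -> f =1 f'.
Proof.
move=> fL fL' ff.
pose L : {linear tens n V -> W} := HB.pack f (GRing.isLinear.Build _ _ _ _ f fL).
pose L' : {linear tens n V -> W} := HB.pack f' (GRing.isLinear.Build _ _ _ _ f' fL').
apply: (@tens_ext _ _ _ _ L L') => a /=; rewrite tpure_codom ff //.
by rewrite size_codom card_ord.
Qed.

Lemma tmap_tprod (V W : gradedType k) n q (bs : seq (block V W)) s :
  size s = n -> sumn [seq bar b | b <- bs] = n -> size bs = q ->
  tmap q bs (tprod n s) = tprod q (tword bs s).
Proof. by move=> sn bsn bsq; rewrite tmap_pure // codom_seq. Qed.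

Lemma tens1_tprod (V : gradedType k) (v : V) : tens1 V (tprod 1 [:: v]) = v.
Proof. by rewrite tens1_pure ffunE. Qed.

Lemma bdeg_nseq0 (V W : gradedType k) t (C : block V W) :
  bdeg C = 0 -> \sum_(b <- nseq t C) bdeg b = 0.
Proof. by move=> C0; rewrite big_nseq C0; elim: t => //= t ->; rewrite addr0. Qed.

Lemma tword_nseq (V W : gradedType k) t (C : block V W) (g : V -> W) s :
  bdeg C = 0 -> bar C = 1%N -> (forall v, bmap C (tprod (bar C) [:: v]) = g v) ->
  size s = t -> tword (nseq t C) s = map g s.
Proof.
case: C => b e f /= -> b1; subst b => fg; elim: t s => [|t IH] [|v s] //= [st].
by rewrite drop0 IH // take0 /= bdeg_nseq0 // koszul0 fg.
Qed.

(** Only B may have nonzero degree, so the only Koszul signs come from moving B past the first r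
    arguments. *)
Lemma tword_insertb (V : gradedType k) r t (B C : block V V) (g : V -> V) s :
  bdeg C = 0 -> bar C = 1%N -> (forall v, bmap C (tprod (bar C) [:: v]) = g v) ->
  size s = (r + bar B + t)%N ->
  tword (insertb r B t C) s
  = map (koszul (bdeg B)) (take r s)
    ++ bmap B (tprod (bar B) (take (bar B) (drop r s)))
    :: map g (drop (r + bar B) s).
Proof.
move=> C0 C1 Cg; elim: r s => [|r IH] s sr /=.
  rewrite take0 drop0 /= (tword_nseq C0 C1 Cg) ?size_drop ?sr ?addKn //.
  rewrite bdeg_nseq0 // (_ : map (koszul 0) _ = take (bar B) s) //.
  by rewrite -[RHS]map_id; apply: eq_map => v; rewrite koszul0.
case: s sr => // v s [sr]; rewrite /= -/(insertb _ _ _ _) drop0 take0 IH //=.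
rewrite tens1_tprod; congr (koszul _ _ :: _).
by rewrite /insertb big_cat big_cons /= !bdeg_nseq0 // addr0 add0r.
Qed.

Lemma sumn_insertb (V : gradedType k) r t (B C : block V V) :
  bar C = 1%N -> sumn [seq bar b | b <- insertb r B t C] = (r + bar B + t)%N.
Proof.
by move=> C1; rewrite map_cat /= !map_nseq sumn_cat /= !sumn_nseq C1 !mul1n addnA.
Qed.

Lemma size_insertb (V : gradedType k) r t (B C : block V V) :
  size (insertb r B t C) = (r + 1 + t)%N.
Proof. by rewrite size_cat /= !size_nseq addnS addnAC addn1. Qed.

(** Any odd e is allowed, to cover both h of degree 1 and d of degree -1. *)
Lemma slideE (V : gradedType k) (W : lmodType k) (f g : V -> V) (e : int)
    (phi : seq V -> W) s :
  odd (absz e) ->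
  slide f g phi s = \sum_(r < size s)
    phi (map (koszul e) (take r s) ++ f (nth 0 s r) :: map g (drop r.+1 s)).
Proof.
move=> eO; elim: s phi => [|v s IH] phi /=; first by rewrite big_ord0.
rewrite big_ord_recl /= drop0 IH; congr (_ + _); apply: eq_bigr => r _ /=.
by rewrite (@koszul_parity _ _ e 1 ((e - 1) %/ 2)%Z) //; lia.
Qed.

Lemma contractE (V W : lmodType k) (mu : V -> V -> V) (phi : seq V -> W) s :
  contract mu phi s = \sum_(r < (size s).-1) (-1) ^+ (size s - 2 - r) *:
    phi (take r s ++ mu (nth 0 s r) (nth 0 s r.+1) :: drop r.+2 s).
Proof.
elim: s phi => [|v [|w s] IH] phi; rewrite ?big_ord0 //=.
  by rewrite addr0.
have := IH (fun t => phi (v :: t)); rewrite /= => ->.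
rewrite big_ord_recl /= drop0 !subSS !subn0; congr (_ + _).
by apply: eq_bigr => r _; rewrite /= -subnDA.
Qed.

Section TensorPowerMaps.
Variables (A : gradedType k) (W : lmodType k).

Lemma slide_tmap n (f g : {linear A -> A}) (e : int) (C : block A A)
  (F : {linear tens n A -> W}) s :
  odd (absz e) -> bdeg C = 0 -> bar C = 1%N ->
  (forall v, bmap C (tprod (bar C) [:: v]) = g v) -> size s = n ->
  \sum_(r < n) F (tmap n (insertb r (block1 e f) (n - 1 - r) C) (tprod n s))
  = slide f g (fun t => F (tprod n t)) s.
Proof.
move=> eO C0 C1 Cg sn; rewrite (slideE _ _ _ _ eO) sn; apply: eq_bigr => r _.
have rn := ltn_ord r.
rewrite tmap_tprod // ?sumn_insertb ?size_insertb /=; [|lia..].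
rewrite (tword_insertb C0 C1 Cg) /= ?sn; last lia.
rewrite addn1 (drop_nth 0) ?sn //= take0 /=.
by rewrite tens1_tprod.
Qed.

Lemma contract_tmap n (B : block A A) (mu : A -> A -> A)
    (F : {linear tens n.-1 A -> W}) s :
  bdeg B = 0 -> bar B = 2 ->
  (forall v w, bmap B (tprod (bar B) [:: v; w]) = mu v w) -> size s = n ->
  \sum_(r < n.-1) (-1) ^+ (n - 2 - r) *:
    F (tmap n.-1 (insertb r B (n - 2 - r) (idblock A)) (tprod n s))
  = contract mu (fun t => F (tprod n.-1 t)) s.
Proof.
case: B => b e f /= -> b2; subst b => fmu sn.
rewrite contractE sn; apply: eq_bigr => r _; have rn := ltn_ord r.
rewrite tmap_tprod // ?sumn_insertb ?size_insertb //=; [|lia..].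
rewrite (@tword_insertb _ _ _ _ _ id) //= ?sn; [|exact: tens1_tprod|lia].
rewrite addn2 map_id (drop_nth 0) ?sn; last lia.
rewrite (drop_nth 0 (n := r.+1)) ?sn /=; last lia.
rewrite take0 fmu; congr (_ *: F (tprod _ (_ ++ _))).
by rewrite -[RHS]map_id; apply: eq_map => v; rewrite koszul0.
Qed.

End TensorPowerMaps.

End TensorsAsLists.

(** * Degrees of slides and contractions *)

Section Degrees.
Variable k : fieldType.
Implicit Types (V W : gradedType k) (js : seq int).

Lemma homogP V j c (u v : V) : homog j u -> homog j v -> homog j (c *: u + v).
Proof. by rewrite /homog linearP /= => -> ->. Qed.

Lemma homog0 V j : homog j (0 : V).
Proof. exact: linear0. Qed.

Lemma homogD V j (u v : V) : homog j u -> homog j v -> homog j (u + v).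
Proof. by move=> hu hv; rewrite -[u]scale1r; apply: homogP. Qed.

Lemma homogZ V j c (v : V) : homog j v -> homog j (c *: v).
Proof. by move=> hv; rewrite -[_ *: _]addr0; apply: homogP hv (homog0 _ _). Qed.

Fixpoint homogs V js (s : seq V) : Prop :=
  match js, s with
  | [::], [::] => True
  | j :: js', v :: s' => homog j v /\ homogs js' s'
  | _, _ => False
  end.

Lemma homogs_map V W (f : V -> W) js s :
  hdeg 0 f -> homogs js s -> homogs js (map f s).
Proof.
move=> f0; elim: js s => [|j js IH] [|v s] //= [hv hs].
by split; [rewrite -[j]addr0; apply: f0 | apply: IH].
Qed.

Lemma koszul_hdeg V e : hdeg 0 (@koszul k V e).
Proof.
by move=> j v hv; rewrite addr0 (koszul_homog _ hv); apply: homogZ.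
Qed.

(** Counterpart of [tdeg] with the degrees in a list, which suits the recursion of [slide] and
    [contract]. *)
Definition listdeg V W n (e : int) (phi : seq V -> W) :=
  forall js s, size s = n -> homogs js s ->
  homog (\sum_(j <- js) j + e) (phi s).

Lemma listdeg_cons V W n e e' (phi : seq V -> W) v :
  homog e' v -> listdeg n.+1 e phi ->
  listdeg n (e' + e) (fun t => phi (v :: t)).
Proof.
move=> hv phie js s sn hs; have := phie (e' :: js) (v :: s).
by rewrite big_cons /= sn addrCA addrA; apply.
Qed.

Lemma listdeg_slide V W n e (f g : V -> V) (phi : seq V -> W) :
  hdeg 1 f -> hdeg 0 g -> listdeg n e phi -> listdeg n (e + 1) (slide f g phi).
Proof.
move=> f1 g0 phie js s; elim: s js n e phi phie => [|v s IH] [|j js] n e phi phie //=.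
  by move=> _ _; apply: homog0.
move=> sn [hv hs]; apply: homogD.
  have := phie (j + 1 :: js) (f v :: map g s); rewrite /= size_map sn !big_cons.
  rewrite (_ : j + 1 + _ + e = j + \sum_(i <- js) i + (e + 1)); last by ring.
  by apply; split; [apply: f1 | apply: homogs_map].
case: n sn phie => // n [sn] phie.
have hkv : homog j (koszul 1 v) by rewrite -[j]addr0; apply: koszul_hdeg.
have := IH js n _ _ (listdeg_cons hkv phie) sn hs.
by rewrite big_cons (_ : _ + (j + e + 1) = j + \sum_(i <- js) i + (e + 1)) //; ring.
Qed.

Lemma listdeg_contract V W n e (mu : V -> V -> V) (phi : seq V -> W) :
  (forall i j v w, homog i v -> homog j w -> homog (i + j) (mu v w)) ->
  listdeg n e phi -> listdeg n.+1 e (contract mu phi).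
Proof.
move=> mu0 phie js s; elim: s js n e phi phie => [|v s IH] [|j js] n e phi phie //=.
move=> [sn] [hv hs]; case: s js sn hs IH => [|w s] [|l js] //= sn.
  by rewrite addr0 => *; apply: homog0.
move=> [hw hs] IH; apply: homogD.
  apply: homogZ; have := phie (j + l :: js) (mu v w :: s).
  by rewrite /= sn !big_cons -!addrA; apply=> //; split=> //; apply: mu0.
case: n sn phie => // n [sn] phie.
have := IH (l :: js) n _ _ (listdeg_cons hv phie).
rewrite /= sn !big_cons (_ : l + _ + (j + e) = j + (l + \sum_(i <- js) i) + e).
  by apply.
by ring.
Qed.

Lemma tdeg_listdeg V W n e (F : tens n V -> W) :
  listdeg n e (fun s => F (tprod n s)) -> tdeg e F.
Proof.
move=> Fe a j hj; rewrite tpure_codom -big_enum -(big_map j xpredT id) /=.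
apply: Fe; first by rewrite size_codom card_ord.
by rewrite /codom /image_mem; elim: (enum _).
Qed.

End Degrees.

Section OnLists.
Variables (k : fieldType) (V : gradedType k) (W : lmodType k)
  (F : forall n, {linear tens n V -> W}).

(** The arity is read off from the length, so recursions that change it need no casts. *)
Definition on_lists (s : seq V) : W := F (size s) (tprod (size s) s).

Lemma on_listsE n s : size s = n -> F n (tprod n s) = on_lists s.
Proof. by move=> <-. Qed.

Lemma multilin_on_lists : multilin on_lists.
Proof.
move=> s1 s2 c u v; rewrite /on_lists !size_cat /= tprod_linear ?linearP //.
by rewrite addnS ltnS leq_addr.
Qed.

End OnLists.

(** * Sums over compositions as block sums *)

Section Compositions.
Variables (k : fieldType) (V W : gradedType k) (U : lmodType k).
Variable F : forall n, {linear tens n V -> W}.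

(** The pairs of indices that involve the first part are separated from the others. *)
Lemma comp_sign_cons j c :
  comp_sign (j :: c) = ((\sum_(l <- c) (l - 1)) * j + comp_sign c)%N.
Proof.
rewrite /comp_sign /= big_ord_recl /=; congr (_ + _)%N.
  rewrite big_mkcond big_ord_recl /= add0n big_distrl /=.
  by rewrite (big_nth 0%N) big_mkord; apply: eq_bigr => l _.
apply: eq_bigr => l _; rewrite big_mkcond big_ord_recl /= add0n [RHS]big_mkcond.
by apply: eq_bigr => m _; rewrite /= ltnS.
Qed.

Lemma big_cons_tuple (R : nmodType) (T : finType) r (Q : pred (seq T))
    (G : seq T -> R) :
  \sum_(c : r.+1.-tuple T | Q c) G c
  = \sum_(x : T) \sum_(c : r.-tuple T | Q (x :: c)) G (x :: c).
Proof.
rewrite pair_big_dep /=.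
rewrite (reindex (fun q : T * r.-tuple T => [tuple of q.1 :: q.2])) //=.
exists (fun c : r.+1.-tuple T => (thead c, [tuple of behead c])) => [[x c] _|c _] /=.
  by congr pair; apply: val_inj.
by rewrite [RHS]tuple_eta; apply: val_inj.
Qed.

Lemma sum_pred c : all (leq 1) c -> (\sum_(l <- c) (l - 1) + size c = sumn c)%N.
Proof. by elim: c => [|l c IH] /=; rewrite ?big_nil ?big_cons // => /andP[l1 /IH]; lia. Qed.

Lemma sum_bdeg c : all (leq 1) c ->
  \sum_(b <- [seq Block (l%:Z - 1) (F l) | l <- c]) bdeg b
  = (\sum_(l <- c) (l - 1))%N%:Z.
Proof.
elim: c => [|l c IH] /=; rewrite ?big_nil ?big_cons // => /andP[l1 /IH ->].
by rewrite /=; lia.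
Qed.

(** Splitting off the first part follows the recursion of [blocksum]; the bound N stays fixed while
    the list shrinks. *)
Lemma blocksum_tword N r (psi : seq W -> U) s : (size s < N)%N ->
  \sum_(c : r.-tuple 'I_N | all (leq 1) (map val c) && (sumn (map val c) == size s))
     (-1) ^+ comp_sign (map val c) *:
        psi (tword [seq Block (l%:Z - 1) (F l) | l <- map val c] s)
  = blocksum (on_lists F) r psi s.
Proof.
elim: r psi s => [|r IH] psi s sN.
  rewrite (eq_bigr (fun=> psi [::])) => [|c _]; last first.
    by rewrite tuple0 /= /comp_sign big_ord0 expr0 scale1r.
  rewrite (eq_bigl (fun=> size s == 0%N)) => [|c]; last by rewrite tuple0 /= eq_sym.
  case: s sN => [|v s] sN /=; last by rewrite big_pred0.
  by rewrite big_const card_tuple expn0 /= addr0.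
rewrite (big_cons_tuple _
   (fun c => all (leq 1) (map val c) && (sumn (map val c) == size s))
   (fun c => (-1) ^+ comp_sign (map val c) *:
        psi (tword [seq Block (l%:Z - 1) (F l) | l <- map val c] s))) /=.
rewrite (big_nat_widenl _ 0) // (big_nat_widen _ _ N) // big_mkord big_mkcond.
rewrite [RHS]big_mkcond /=; apply: eq_bigr => j _; case: ifP => [/andP[j1 js]|jF].
  rewrite -IH; last by rewrite size_drop; lia.
  rewrite scaler_sumr; apply: eq_big => [c|c].
    rewrite j1 /= size_drop; congr (_ && _); lia.
  move=> /andP[/andP[_ c1] /eqP sc].
  have := sum_pred c1; rewrite size_map size_tuple => e.
  rewrite comp_sign_cons scalerA -exprD /= sum_bdeg //.
  rewrite (on_listsE F (n := j)); last by rewrite size_map size_takel.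
  (* [e1] is the degree of the remaining r blocks, [e2] the exponent in [blocksum]. They agree
     modulo 2, since e1 + r is the number of remaining entries. *)
  set e1 := (\sum_(l <- _) _)%N in e *; set e2 := (size _ + r)%N.
  have e12 : odd e1 = odd e2 by rewrite /e2 size_drop; lia.
  congr (_ *: psi (_ :: _)).
    by apply: signr_parity; rewrite !oddD !oddM e12.
  congr on_lists; apply: eq_map => v.
  by apply: (@koszul_parity _ _ _ _ ((e1%:Z - e2%:Z) %/ 2)%Z); lia.
(* No composition has a first part that is 0 or exceeds the length. *)
rewrite big_pred0 // => c; apply/negP => /andP[/andP[/= j1 _] /eqP sc].
by move: jF; rewrite j1 /=; lia.
Qed.

End Compositions.

(** * The product of the dg-algebra as a bilinear map *)

Section DgAlgebra.
Variables (k : fieldType) (A : dgAlgebra k).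

Definition dga_mu (v w : A) : A := dga_mul A (tprod 2 [:: v; w]).

Lemma dga_mu_linearl w : linear (dga_mu^~ w).
Proof.
move=> c u v; rewrite /dga_mu.
by rewrite (@tprod_linear _ A 2 [::] [:: w] isT c u v) linearP.
Qed.

Lemma dga_mu_linearr v : linear (dga_mu v).
Proof.
move=> c u w; rewrite /dga_mu.
by rewrite (@tprod_linear _ A 2 [:: v] [::] isT c u w) linearP.
Qed.

Lemma dga_muA u v w : dga_mu (dga_mu u v) w = dga_mu u (dga_mu v w).
Proof.
have := dga_mulA (tprod 3 [:: u; v; w]).
by rewrite !tmap_tprod //= !big_cons !big_nil /= !addr0 !koszul0 !tens1_tprod.
Qed.

Lemma dga_mu_leibniz v w :
  cdiff A (dga_mu v w) = dga_mu (cdiff A v) w + dga_mu (koszul 1 v) (cdiff A w).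
Proof.
rewrite dga_leibniz linearD !tmap_tprod //= !big_cons !big_nil /= !addr0.
by rewrite !koszul0 !tens1_tprod (@koszul_parity _ _ (-1) 1 (-1)).
Qed.

Lemma dga_mu_homog i j (v w : A) :
  homog i v -> homog j w -> homog (i + j) (dga_mu v w).
Proof.
move=> hv hw.
have := @dga_mul_deg _ A [ffun l : 'I_2 => [:: v; w]`_l] (nth 0 [:: i; j]).
rewrite !big_ord_recl big_ord0 /= !addr0; apply.
by case=> [[|[|]]] // ?; rewrite ffunE.
Qed.

(** Degrees add under the product; linearity in each factor reduces to homogeneous ones. *)
Lemma dga_mu_koszul v w :
  koszul 1 (dga_mu v w) = dga_mu (koszul 1 v) (koszul 1 w).
Proof.
have koszul_muL u : linear (fun x => koszul 1 (dga_mu x u)).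
  by move=> c x y; rewrite dga_mu_linearl linearP.
have koszul_muR u : linear (fun x => koszul 1 (dga_mu u x)).
  by move=> c x y; rewrite dga_mu_linearr linearP.
have mu_koszulL u : linear (fun x => dga_mu (koszul 1 x) u).
  by move=> c x y; rewrite linearP dga_mu_linearl.
have mu_koszulR u : linear (fun x => dga_mu u (koszul 1 x)).
  by move=> c x y; rewrite linearP dga_mu_linearr.
move: v; apply: eq_on_homog => // i v hv.
move: w; apply: eq_on_homog => // j w hw.
rewrite (koszul_homog _ (dga_mu_homog hv hw)) (koszul_homog _ hv) (koszul_homog _ hw).
rewrite (linear_funZ _ _ (dga_mu_linearl _)) (linear_funZ _ _ (dga_mu_linearr _)).
rewrite scalerA -exprD; congr (_ *: _).
by apply: (sign_absz_odd _ (b := Posz _)); lia.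
Qed.

End DgAlgebra.

(** * The transferred maps on lists *)

Section TransferOnLists.
Variables (k : fieldType) (A : dgAlgebra k).
Local Notation H := (homology A).
Variables (p : {linear A -> H}) (i : {linear H -> A}) (h : {linear A -> A}).
Local Notation mu := (@dga_mu k A).
Local Notation P := (on_lists (transfer_p p i h)).
Local Notation M := (on_lists (transfer_m p i h)).

Lemma h_op_tprod (W : lmodType k) n (F : {linear tens n A -> W}) s : size s = n ->
  F (h_op p i h (tprod n s)) = slide h (i \o p) (fun t => F (tprod n t)) s.
Proof.
move=> sn; rewrite /h_op linear_sum.
by rewrite -(@slide_tmap _ _ _ _ h (i \o p) 1 (block1 0 (i \o p))) // => v;
  rewrite /= tens1_tprod.
Qed.

Lemma nu_op_tprod (W : lmodType k) n (F : {linear tens n.-1 A -> W}) s :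
  size s = n ->
  F (nu_op (tprod n s)) = contract mu (fun t => F (tprod n.-1 t)) s.
Proof.
move=> sn; rewrite -(@contract_tmap _ _ _ _ (Block 0 (dga_mul A))) // linear_sum.
by apply: eq_bigr => r _; rewrite linearZ.
Qed.

Lemma transfer_p1 v : P [:: v] = p v.
Proof. by rewrite /on_lists /= tens1_tprod. Qed.

Lemma transfer_pS s : (1 < size s)%N ->
  P s = (-1) ^+ size s *: slide h (i \o p) (contract mu P) s.
Proof.
case sn: (size s) => [|[|n]] // _; rewrite -(on_listsE _ sn) /=; congr (_ *: _).
have /= -> := h_op_tprod (transfer_p_rec p i h n \o @nu_op k A n.+2) sn.
apply: eq_slide => t; rewrite sn => tn /=.
rewrite (nu_op_tprod (n := n.+2) (transfer_p_rec p i h n) tn).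
by apply: eq_contract => u; rewrite tn => -[un]; rewrite -(on_listsE _ un).
Qed.

(** Unrolling the recursion collects signs; the induction step is alpha_(m+1) = (-1)^m alpha_m, by
    the Pascal rule for binomial(m + 1, 2). *)
Lemma transfer_p_nu n (x : tens n.+2 A) :
  transfer_p_rec p i h n (nu_op x) = - alpha_sign k n.+2 *: p (nu_chain p i h n x).
Proof.
elim: n x => [|n IH] x.
  have -> : - alpha_sign k 2 = 1 by rewrite /alpha_sign expr1 opprK.
  rewrite scale1r /= /nu_op big_ord1 subnn expr0 scale1r /=. congr (p _).
  (* nu_2 has values in the first tensor power, which [tens1] identifies with A. *)
  move: x; apply: (@tens_tprod_ext _ _ _ _ (tens1 A \o tmap 1 _)) => [||s s2].
  - exact: linearP.
  - exact: linearP.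
  case: s s2 => [|v [|w [|//]]] // _.
  by rewrite /= tmap_tprod //= big_nil !koszul0 tens1_tprod.
rewrite /= IH scalerA; congr (_ *: _).
rewrite mulrN; congr (- _); rewrite /alpha_sign -exprD; apply: signr_parity.
by rewrite !subn1 -!bin2 (binS n.+2 1) bin1 addnC.
Qed.

(** By [transfer_p_nu], P_(n-1) nu_n i^{(x) n} = m_n. *)
Lemma transfer_mP s : (1 < size s)%N ->
  contract mu P (map (i \o p) s) = M (map p s).
Proof.
case sn: (size s) => [|[|n]] // _.
rewrite -(on_listsE (transfer_m p i h) (n := n.+2)) ?size_map //.
rewrite -(@eq_contract _ _ _ _
  (fun t => transfer_p_rec p i h n (tprod n.+1 t))); last first.
  by move=> t; rewrite size_map sn => -[tn]; rewrite -(on_listsE _ tn).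
rewrite -(nu_op_tprod (n := n.+2)) ?size_map // transfer_p_nu.
have iE t : size t = n.+2 ->
    tmap n.+2 (nseq n.+2 (block1 0 i)) (tprod n.+2 t) = tprod n.+2 (map i t).
  move=> tn; rewrite tmap_tprod ?size_nseq // ?map_nseq ?sumn_nseq ?mul1n //.
  by rewrite (@tword_nseq _ _ _ _ _ i) // => v; rewrite /= tens1_tprod.
by rewrite [RHS]/= iE ?size_map // -map_comp.
Qed.

(** Each step of the recursion adds the degree of h, as nu and ip have degree 0. *)
Lemma transfer_p_deg n : hdeg 0 p -> hdeg 0 i -> hdeg 1 h ->
  tdeg (n.+1%:Z - 1) (transfer_p p i h n.+1).
Proof.
move=> p0 i0 h1; apply: tdeg_listdeg; elim: n => [|n IH].
  move=> js [|v [|//]] // _; case: js => [[]|j [[hv _]|? ? [_ []]]].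
  rewrite /= tens1_tprod big_seq1 (_ : j + _ = j + 0); first exact: p0.
  by rewrite addr0; ring.
have ip0 : hdeg 0 (i \o p).
  by move=> j v hv; have := i0 _ _ (p0 _ _ hv); rewrite !addr0.
have := listdeg_slide h1 ip0 (listdeg_contract (@dga_mu_homog _ A) IH).
rewrite (_ : n.+1%:Z - 1 + 1 = n.+2%:Z - 1); last by lia.
move=> Hd js s sn hs; have := Hd js s sn hs.
rewrite (on_listsE (transfer_p p i h) sn) transfer_pS ?sn // => Hs; apply: homogZ.
rewrite (@eq_slide _ _ _ _ _ _
  (contract mu (fun t => transfer_p p i h n.+1 (tprod n.+1 t)))) // => t.
rewrite sn => tn; apply: eq_contract => u; rewrite tn => -[un].
by rewrite -(on_listsE _ un).
Qed.

End TransferOnLists.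

(** * The left side of the morphism equation for a dg-algebra *)

Section LeftHandSide.
Variables (k : fieldType) (A : dgAlgebra k) (W : gradedType k).
Variable F : forall n, {linear tens n A -> W}.

Lemma dga_Ainf_insert n s : (0 < n)%N -> size s = n ->
  \sum_(1 <= l < n.+1) \sum_(0 <= r < (n - l).+1)
       (let t := (n - l - r)%N in
        (-1) ^+ (r * l + t) *:
          F (r + t + 1)%N
            (tmap _ (insertb r (Block (l%:Z - 2) (dga_Ainf A l)) t (idblock A))
               (tprod n s)))
  = morphism_lhs (on_lists F) (cdiff A) (@dga_mu k A) s.
Proof.
move=> n_gt0 sn.
have termE l r : (1 <= l)%N -> (l + r <= n)%N ->
  F (r + (n - l - r) + 1)%N (tmap _ (insertb r (Block (l%:Z - 2) (dga_Ainf A l))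
     (n - l - r) (idblock A)) (tprod n s))
  = on_lists F (map (koszul (l%:Z - 2)) (take r s)
      ++ dga_Ainf A l (tprod l (take l (drop r s))) :: drop (r + l) s).
  move=> l_gt0 lrn.
  rewrite tmap_tprod ?sumn_insertb ?size_insertb //=; [|lia..].
  rewrite (on_listsE F); last by rewrite size_tword size_insertb; lia.
  rewrite (@tword_insertb _ _ _ _ _ _ id) /= ?map_id //; last by rewrite sn; lia.
  by move=> v; rewrite tens1_tprod.
rewrite big_ltn // /morphism_lhs sn; congr (_ + _).
  rewrite (@slideE _ _ _ _ _ (1%:Z - 2)) // sn scaler_sumr big_mkord.
  have nE : (n - 1).+1 = n by lia.
  rewrite nE; apply: eq_bigr => r _ /=; have rn := ltn_ord r.
  rewrite termE //.
  congr (_ *: _); first by congr (_ ^+ _); lia.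
  rewrite map_id addn1 (drop_nth 0) ?sn //= take0 tens1_tprod.
  by [].
(* For n = 1 there is no index l >= 2, and a single entry has no contraction. *)
case: n n_gt0 sn termE => [//|[|n]] _ sn termE.
  rewrite big_geq //; case: s sn {termE} => [|v [|]] //= _.
  by rewrite addr0.
rewrite big_ltn // [X in _ + X](_ : _ = 0).
  rewrite addr0 contractE sn big_mkord (_ : (n.+2 - 2).+1 = n.+2.-1); last by lia.
  apply: eq_bigr => r _ /=.
  have rn := ltn_ord r; rewrite termE //.
  congr (_ *: _); first by apply: signr_parity; lia.
  have [r1 r2] : (r < size s)%N /\ (r.+1 < size s)%N by rewrite sn; lia.
  rewrite (drop_nth 0 r1) (drop_nth 0 r2) /=.
  (* The degree 2 - 2 of m_2 computes to 0, so no Koszul sign arises. *)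
  rewrite take0 addn2 -[map _ _]/(map (koszul 0) _).
  by rewrite (@map_koszul_even _ _ 0).
rewrite big_nat big1 // => l /andP[l2 ln]; rewrite big_nat big1 // => r rl /=.
rewrite termE; [|lia..].
(* For l >= 3 the operation m_l is zero, which puts 0 into one slot. *)
case: l l2 ln rl => [|[|[|l]]] // _ _ _ /=.
by rewrite (multilin0 _ _ (multilin_on_lists F)) scaler0.
Qed.

End LeftHandSide.

Theorem theorem7p6 (k : fieldType) (A : dgAlgebra k)
    (p : {linear A -> homology A}) (i : {linear homology A -> A})
    (h : {linear A -> A})
    (p_deg : hdeg 0 p) (i_deg : hdeg 0 i) (h_deg : hdeg 1 h)
    (p_chain : forall a, p (cdiff A a) = 0)
    (i_chain : forall x, cdiff A (i x) = 0)
    (pi_id : forall x, p (i x) = x)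
    (homotopy : forall a, a - i (p a) = cdiff A (h a) + h (cdiff A a))
    (hh : forall a, h (h a) = 0)
    (ph : forall a, p (h a) = 0)
    (hi : forall x, h (i x) = 0)
    (m_Ainf : Ainf_algebra (transfer_m p i h)) :
  Ainf_morphism (dga_Ainf A) (transfer_m p i h) (transfer_p p i h).
Proof.
split=> [[//|n] _|n n_gt0 x]; first exact: transfer_p_deg.
(* Both sides become functions of the tensor, so that linearity reduces the equation to pure
   tensors. *)
pose lhs (y : tens n A) := \sum_(1 <= l < n.+1) \sum_(0 <= r < (n - l).+1)
  (let t := (n - l - r)%N in
    (-1) ^+ (r * l + t) *:
      transfer_p p i h (r + t + 1)%N
        (tmap _ (insertb r (Block (l%:Z - 2) (dga_Ainf A l)) t (idblock A)) y)).
pose rhs (y : tens n A) := \sum_(1 <= r < n.+1)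
  \sum_(c : r.-tuple 'I_n.+1 | all (leq 1) (map val c) && (sumn (map val c) == n))
    (-1) ^+ comp_sign (map val c) *: transfer_m p i h r
      (tmap r [seq Block (s%:Z - 1) (transfer_p p i h s) | s <- map val c] y).
have lhsL : linear lhs.
  move=> c u v; rewrite /lhs scaler_sumr -big_split; apply: eq_bigr => l _ /=.
  rewrite scaler_sumr -big_split; apply: eq_bigr => r _ /=.
  by rewrite linearP linearP scalerDr !scalerA mulrC.
have rhsL : linear rhs.
  move=> c u v; rewrite /rhs scaler_sumr -big_split; apply: eq_bigr => l _ /=.
  rewrite scaler_sumr -big_split; apply: eq_bigr => r _ /=.
  by rewrite linearP linearP scalerDr !scalerA mulrC.
suff: lhs =1 rhs by apply.
apply: tens_tprod_ext => // s sn.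
rewrite /lhs dga_Ainf_insert //.
(* The first goal left turns block sums back into sums over compositions; the others check the
   hypotheses of the recursion, the sign rules coming from the degrees of d, h, i and p. *)
rewrite (@morphism_eq _ _ _ _ (on_lists (transfer_m p i h)) p (cdiff A) h (i \o p)).
- rewrite /morphism_rhs sn; apply: eq_big_nat => r _.
  rewrite -(@blocksum_tword _ _ _ _ _ n.+1) ?sn //.
  apply: eq_bigr => c /andP[_ /eqP cn]; congr (_ *: _).
  have szc : size [seq Block (l%:Z - 1) (transfer_p p i h l) | l <- map val c] = r.
    by rewrite !size_map size_tuple.
  rewrite tmap_tprod ?(on_listsE (transfer_m p i h)) ?size_tword //.
  by rewrite -map_comp map_id_in.
- exact: multilin_on_lists.
- exact: multilin_on_lists.
- exact: transfer_p1.
- exact: dga_mu_linearl.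
- exact: dga_mu_linearr.
- exact: dga_muA.
- exact: dga_mu_leibniz.
- exact: dga_mu_koszul.
- by move=> v; rewrite (koszul1_hdeg (@cdiff_deg _ A)) expr1 scaleN1r.
- by move=> v; rewrite (koszul1_hdeg h_deg) expr1 scaleN1r.
- move=> v; rewrite /= (koszul1_hdeg i_deg) expr0 scale1r.
  by rewrite (koszul1_hdeg p_deg) expr0 scale1r.
- by move=> v; rewrite /= i_chain p_chain linear0.
- exact: homotopy.
- exact: hh.
- by move=> v; apply: hi.
- by move=> v; rewrite /= ph linear0.
- exact: ph.
- by move=> v; apply: pi_id.
- exact: p_chain.
- exact: transfer_pS.
- by [].
- exact: transfer_mP.
- by rewrite sn.
Qed.
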